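(* Let $n,m\ge 1$. Let $\mathrm{Func}(\mathrm{wt}(m\varpi_1),S(\mathfrak{h}^* ))$ be the algebra of $S(\mathfrak{h}^* )$-valued functions on $\mathrm{wt}(m\varpi_1)$. There exists an injective $S(\mathfrak{h}^* )^W$-algebra homomorphism $$\mathfrak{i}_m:\mathscr{B}(m\varpi_1)\to\mathrm{Func}(\mathrm{wt}(m\varpi_1),S(\mathfrak{h}^* )).$$ Namely, $\mathfrak{i}_m$ sends $F\in\mathscr{B}(m\varpi_1)$ to the function $\hat F$ such that the operator $F(Y)$ acts as multiplication by $(\hat F(\mu))(Y)$ on the weight space $V_\mu(m\varpi_1)$ for all $\mu\in\mathrm{wt}(m\varpi_1)$ and $Y\in\mathfrak{h}$. The image $\mathfrak{i}_m(\mathscr{B}(m\varpi_1))\simeq\mathscr{B}(m\varpi_1)$ is the subalgebra of $\mathrm{Func}(\mathrm{wt}(m\varpi_1),S(\mathfrak{h}^* ))$ generated by the following two subalgebras: (1) the subalgebra $\mathcal{F}^{(m)}_0$ of constant maps $\mu\mapsto f$ for $f\in S(\mathfrak{h}^* )^W\simeq\mathbb{C}[t_1,\dots,t_n]^{\mathfrak{S}_n}$; (2) the subalgebra $\mathcal{F}^{(m)}_1$ of maps $\mu\mapsto f(\underbrace{t_1,\dots,t_1}_{\mu_1},\dots,\underbrace{t_n,\dots,t_n}_{\mu_n})$ for $f\in\Lambda_m$, where $\Lambda_m$ is the ring of symmetric polynomials in $m$ variables.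
   Context: $\mathfrak{gl}_n$ (complex $n\times n$ matrices) has matrix units $E_{ij}$ and coordinates $y_{ij}$; $c_k(Y)$ is the sum of the principal $k\times k$ minors of $Y$ ($c_0=1$). $\mathfrak{h}\subset\mathfrak{gl}_n$ is the subalgebra of diagonal matrices, $S(\mathfrak{h}^* )=\mathbb{C}[t_1,\dots,t_n]$ with $t_i$ the $i$-th diagonal entry, and $W=\mathfrak{S}_n$; restriction to $\mathfrak{h}$ identifies $S(\mathfrak{gl}_n^* )^{\mathfrak{gl}_n}$ with $S(\mathfrak{h}^* )^W=\mathbb{C}[t_1,\dots,t_n]^{\mathfrak{S}_n}$. $V(m\varpi_1)=S^m(\mathbb{C}^n)$ is the irreducible $\mathrm{GL}_n$-representation with highest weight $m\varpi_1$, where $\varpi_1$ is the first fundamental weight; write $\pi:\mathfrak{gl}_n\to\mathrm{End}\,V(m\varpi_1)$. Its set of weights $\mathrm{wt}(m\varpi_1)$ is identified with the set of $n$-tuples $\mu=(\mu_1,\dots,\mu_n)$ of non-negative integers with $\mu_1+\dots+\mu_n=m$ (via $\mu=\sum\mu_i\varepsilon_i$, $\{\varepsilon_i\}$ dual to $\{E_{ii}\}$), and each weight space $V_\mu(m\varpi_1)$ is one-dimensional. The Kirillov algebra $\mathscr{C}(V)$, $V=V(m\varpi_1)$, is the algebra of $\mathrm{GL}_n$-equivariant polynomial maps $\mathfrak{gl}_n\to\mathrm{End}\,V$; $c\in S(\mathfrak{gl}_n^* )^{\mathfrak{gl}_n}$ is identified with $Y\mapsto c(Y)\,\mathrm{Id}_V$.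 The Kirillov--Wei operator is $(\mathbf{D}F)(Y)=\sum_{i,j=1}^n\frac{\partial F}{\partial y_{ji}}(Y)\cdot\pi(E_{ij})$. The big algebra $\mathscr{B}(m\varpi_1)$ is the subalgebra of $\mathscr{C}(V)$ generated by $\mathbf{D}^q(c_{p+q})$ for $p,q\ge0$, $p+q\le n$. *)

(* Defs.v *)
From HB Require Import structures.
From mathcomp Require Import all_boot all_order all_algebra.
From mathcomp Require Import boolp reals complex mpoly.

Set Implicit Arguments.
Unset Strict Implicit.
Unset Printing Implicit Defensive.

Import Order.TTheory GRing.Theory Num.Theory.
Local Open Scope ring_scope.

(* The C-subalgebra generated by G in a ring A that is a C-algebra through the
   structure map iota. *)
Inductive gen_subalgebra (C A : pzRingType) (iota : C -> A) (G : A -> Prop) :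
    A -> Prop :=
| gen_in x of G x : gen_subalgebra iota G x
| gen_const a : gen_subalgebra iota G (iota a)
| gen_opp x of gen_subalgebra iota G x : gen_subalgebra iota G (- x)
| gen_add x y of gen_subalgebra iota G x & gen_subalgebra iota G y :
    gen_subalgebra iota G (x + y)
| gen_mul x y of gen_subalgebra iota G x & gen_subalgebra iota G y :
    gen_subalgebra iota G (x * y).

(* S(gl_n^* ): the coordinate y_ij is the variable of index mxvec_index i j. *)
Notation Sgl R n := {mpoly (complex R)[n * n]}.

(* S(h^* ) = C[t_1, ..., t_n] *)
Notation Sh R n := {mpoly (complex R)[n]}.

(* wt(m varpi_1): the n-tuples of natural numbers with sum m *)
Definition weight (n m : nat) := {mu : 'X_{1..n < m.+1} | mdeg mu == m}.

(* polynomial maps gl_n -> End V, in the monomial basis of V = S^m(C^n) *)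
Notation polmap R n m := 'M[Sgl R n]_#|{: weight n m}|.

Notation Func R n m := {ffun weight n m -> Sh R n}.

Section BigAlgebra.
Variables (R : realType) (n m : nat).

Local Notation C := (complex R).
Local Notation Sgl := (Sgl R n).
Local Notation Sh := (Sh R n).
Local Notation polmap := (polmap R n m).
Local Notation Func := (Func R n m).

Definition generic_mx : 'M[Sgl]_n :=
  \matrix_(i, j) 'X_(mxvec_index i j).

Definition eval_gl (Y : 'M[C]_n) (c : Sgl) : C := c.@[fun k => mxvec Y 0 k].

Definition restrict_h (c : Sgl) : Sh :=
  c \mPo [tuple mxvec (diag_mx (\row_(i < n) ('X_i : Sh))) 0 k
           | k < n * n].

(* S(gl_n^* )^{gl_n}: the derivative of c at Y in the direction [A, Y] vanishes
   for every A in gl_n. *)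
Definition gl_invariant (c : Sgl) : Prop :=
  forall A : 'M[C]_n,
    let A' := map_mx (@mpolyC (n * n) C) A in
    \sum_i \sum_j mderiv (mxvec_index i j) c
                  * (A' *m generic_mx - generic_mx *m A') i j = 0.

Definition char_coef (k : nat) : Sgl :=
  \sum_(A : {set 'I_n} | #|A| == k)
     \det (mxsub (@enum_val _ (mem A)) (@enum_val _ (mem A)) generic_mx).

Local Notation weight := (weight n m).

Definition weight_mnm (mu : weight) : 'X_{1..n} := val (val mu).

Local Notation N := #|{: weight}|.

(* V = S^m(C^n) is the space of homogeneous polynomials of degree m in
   x_1, ..., x_n, with x_i standing for the i-th basis vector of C^n.  It is
   identified with 'cV[C]_N through the basis of monomials; op_mx T is the
   matrix, acting on column vectors, of a linear operator T preserving V. *)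
Definition basis_mnm (a : 'I_N) : 'X_{1..n} := weight_mnm (enum_val a).

Definition op_mx (T : {mpoly C[n]} -> {mpoly C[n]}) : 'M[C]_N :=
  \matrix_(a, b) (T 'X_[basis_mnm b])@_(basis_mnm a).

Definition rho (g : 'M[C]_n) : 'M[C]_N :=
  op_mx (fun p => p \mPo [tuple \sum_i g i j *: 'X_i | j < n]).

(* the differential of rho: E_ij acts as x_i d/dx_j *)
Definition pi_gl (A : 'M[C]_n) : 'M[C]_N :=
  op_mx (fun p => \sum_i \sum_j A i j *: ('X_i * mderiv j p)).

Definition weight_space (mu : weight) (v : 'cV[C]_N) : Prop :=
  forall d : 'rV[C]_n,
    pi_gl (diag_mx d) *m v = (\sum_i d 0 i *+ weight_mnm mu i) *: v.

Definition eval_polmap (F : polmap) (Y : 'M[C]_n) : 'M[C]_N :=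
  map_mx (eval_gl Y) F.

Definition equivariant : pred polmap := fun F =>
  `[< forall g Y : 'M[C]_n, g \in unitmx ->
        eval_polmap F (g *m Y *m invmx g) *m rho g
        = rho g *m eval_polmap F Y >].

Definition KW (F : polmap) : polmap :=
  \sum_i \sum_j map_mx (mderiv (mxvec_index j i)) F
                *m map_mx (@mpolyC (n * n) C) (pi_gl (delta_mx i j)).

Lemma eval_polmapB F G Y :
  eval_polmap (F - G) Y = eval_polmap F Y - eval_polmap G Y.
Proof. by apply/matrixP => i j; rewrite !mxE /eval_gl mevalB. Qed.

Lemma eval_polmapM F G Y :
  eval_polmap (F * G) Y = eval_polmap F Y *m eval_polmap G Y.
Proof.
apply/matrixP => i j; rewrite !mxE /eval_gl raddf_sum.
by apply: eq_bigr => k _; rewrite !mxE; exact: mevalM.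
Qed.

Lemma eval_polmap_scalar (c : Sgl) Y :
  eval_polmap (c%:M) Y = (eval_gl Y c)%:M.
Proof. by apply/matrixP => i j; rewrite !mxE /eval_gl raddfMn. Qed.

Lemma equivariant_const (a : C) : equivariant ((a%:MP : Sgl)%:M).
Proof.
apply/asboolP => g Y _.
by rewrite !eval_polmap_scalar /eval_gl !mevalC scalar_mxC.
Qed.

Lemma equivariant_subring : subring_closed equivariant.
Proof.
split=> [|F G /asboolP hF /asboolP hG|F G /asboolP hF /asboolP hG].
- by have := equivariant_const 1; rewrite mpolyC1.
- apply/asboolP => g Y hg.
  by rewrite !eval_polmapB mulmxBl mulmxBr hF // hG.
- apply/asboolP => g Y hg.
  by rewrite !eval_polmapM -mulmxA hG // !mulmxA hF.
Qed.

HB.instance Definition _ :=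
  GRing.isSubringClosed.Build polmap equivariant equivariant_subring.

(* the Kirillov algebra of V *)
Record kirillov := Kirillov
  { kirillov_map :> polmap; _ : kirillov_map \in equivariant }.

HB.instance Definition _ := [isSub for kirillov_map].
HB.instance Definition _ := [Choice of kirillov by <:].
HB.instance Definition _ :=
  GRing.SubChoice_isSubPzRing.Build _ _ kirillov (subringClosedP _).

Definition kirillov_const (a : C) : kirillov :=
  Kirillov (equivariant_const a).

Definition big_generator (F : kirillov) : Prop :=
  exists p q : nat, (p + q <= n)%N /\
    (F : polmap) = iter q KW ((char_coef (p + q))%:M).

Definition in_big : pred kirillov := fun F =>
  `[< gen_subalgebra kirillov_const big_generator F >].

Lemma in_big_subring : subring_closed in_big.
Proof.
split=> [|F G /asboolP hF /asboolP hG|F G /asboolP hF /asboolP hG];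
  apply/asboolP.
- have -> : (1 : kirillov) = kirillov_const 1.
    by apply: val_inj; rewrite /= mpolyC1.
  exact: gen_const.
- exact: gen_add hF (gen_opp hG).
- exact: gen_mul hF hG.
Qed.

HB.instance Definition _ :=
  GRing.isSubringClosed.Build kirillov in_big in_big_subring.

Record big_algebra := BigAlgebra
  { big_kirillov :> kirillov; _ : big_kirillov \in in_big }.

HB.instance Definition _ := [isSub for big_kirillov].
HB.instance Definition _ := [Choice of big_algebra by <:].
HB.instance Definition _ :=
  GRing.SubChoice_isSubPzRing.Build _ _ big_algebra (subringClosedP _).

Definition Func_const (f : Sh) : Func := [ffun => f].

Definition Func_iota (a : C) : Func := Func_const a%:MP.

Definition F0 (h : Func) : Prop :=
  exists2 f : Sh, f \is symmetric & h = Func_const f.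

(* the variables t_1, ..., t_1, ..., t_n, ..., t_n, each t_i repeated mu_i
   times; the default value of nth is never reached since mu has degree m *)
Definition repeated_vars (mu : weight) : m.-tuple Sh :=
  [tuple nth 0 (flatten [seq nseq (weight_mnm mu i) 'X_i | i <- enum 'I_n]) k
    | k < m].

Definition F1 (h : Func) : Prop :=
  exists2 f : {mpoly C[m]}, f \is symmetric &
    h = [ffun mu => f \mPo repeated_vars mu].

End BigAlgebra.

(* Main.v *)
Require Import Defs.
From HB Require Import structures.
From mathcomp Require Import all_boot all_order all_algebra.
From mathcomp Require Import perm boolp reals complex mpoly.

(** Write M = X + Y over C[gl_n][X], so that det M = sum_k c_k(Y) X^(n-k).
    Jacobi's formula gives D c_k = pi(A_(n-k)), where A_r is the coefficient of
    X^r in adj M.  On S^m(C^n) one has pi(E_kl) = x_k d/dx_l, and the derivative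
    of (adj M)_kl with respect to y_ji is antisymmetric in (i, k); hence in
    D(pi(A_r)) the normally ordered part of pi(E_kl) pi(E_ij) cancels and the
    contraction leaves D(pi(A_r)) = - (r+1) pi(A_(r+1)).  So D^q(c_(p+q)) with
    q > 0 is a scalar multiple of some pi(A_r), and the big algebra is generated
    by the c_k and the pi(A_r).

    An equivariant F commutes on diagonal Y with the torus, hence acts by
    scalars on the one-dimensional weight spaces; matrices with distinct
    eigenvalues being dense, F is determined by these scalars.  At Y = diag(t),
    pi(A_r) acts on the weight mu by sum_a mu_a [X^r] prod_(b != a) (X + t_b),
    which equals sum_i s_i [X^(r+1+i)] prod_b (X + t_b) with the signed power
    sums s_i = sum_a mu_a (- t_a)^i.  By Newton's identities the s_i generate
    F1, and the coefficients of prod_b (X + t_b) generate F0. *)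

Set Implicit Arguments.
Unset Strict Implicit.
Unset Printing Implicit Defensive.

Import Order.TTheory GRing.Theory Num.Theory.
Local Open Scope ring_scope.

(** * Determinants and derivations *)

Section Determinants.
Variable S : comNzRingType.

(** Sylvester's identity: the block matrix with rows (1, -U) and (W, 1) is a product of two
    block-triangular matrices in two ways, and comparing determinants gives the two sides. *)
Lemma det_1D_mulmxC (n k : nat) (U : 'M[S]_(n, k)) (W : 'M[S]_(k, n)) :
  \det (1%:M + U *m W) = \det (1%:M + W *m U).
Proof.
have e1 : block_mx 1%:M (- U) W 1%:M
    = block_mx 1%:M 0 W 1%:M *m block_mx 1%:M (- U) 0 (1%:M + W *m U).
  rewrite mulmx_block !mul1mx !mul0mx !mulmx1 !addr0 mulmxN.
  by rewrite addrC addrK.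
have e2 : block_mx 1%:M (- U) W 1%:M
    = block_mx (1%:M + U *m W) (- U) 0 1%:M *m block_mx 1%:M 0 W 1%:M.
  by rewrite mulmx_block !mul1mx !mul0mx !mulmx1 !mulmx0 mulNmx !add0r addrK.
have := congr1 determinant e1; rewrite {1}e2 !det_mulmx.
by rewrite !det_ublock !det_lblock !det1 !mul1r !mulr1.
Qed.

(* U is the inclusion of the rows indexed by A, so that the matrix on the left
   is 1 + U (U^T M - U^T). *)
Lemma det_principal_minor (n : nat) (A : {set 'I_n}) (M : 'M[S]_n) :
  \det (\matrix_(i, j) (if i \in A then M i j else (i == j)%:R))
  = \det (mxsub (@enum_val _ (mem A)) (@enum_val _ (mem A)) M).
Proof.
pose U := (\matrix_(i, a) (i == enum_val a)%:R : 'M[S]_(n, #|A|)).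
have UM p (N : 'M[S]_(n, p)) a j : (U^T *m N) a j = N (enum_val a) j.
  rewrite mxE (bigD1 (enum_val a)) //= !mxE eqxx mul1r big1 ?addr0 // => i.
  by rewrite !mxE => /negbTE->; rewrite mul0r.
have MU p (N : 'M[S]_(p, n)) a j : (N *m U) a j = N a (enum_val j).
  rewrite mxE (bigD1 (enum_val j)) //= !mxE eqxx mulr1 big1 ?addr0 // => i.
  by rewrite !mxE => /negbTE->; rewrite mulr0.
have UU : U^T *m U = 1%:M.
  by apply/matrixP => a b; rewrite UM !mxE (inj_eq enum_val_inj).
transitivity (\det (1%:M + U *m (U^T *m M - U^T))).
  congr determinant; apply/matrixP => i j; rewrite !mxE.
  case: ifPn => [iA | iA].
    rewrite (bigD1 (enum_rank_in iA i)) //= big1 => [|a ne]; last first.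
      rewrite mxE; case: eqP => [ei|_]; last by rewrite mul0r.
      by have := enum_valK_in iA a; rewrite -ei => er; rewrite er eqxx in ne.
    rewrite mxE enum_rankK_in // eqxx mul1r mxE UM !mxE enum_rankK_in //.
    by rewrite addr0 [j == i]eq_sym addrCA subrr addr0.
  rewrite big1 ?addr0 // => a _; rewrite mxE; case: eqP => [ei|_].
    by rewrite ei enum_valP in iA.
  by rewrite mul0r.
rewrite det_1D_mulmxC mulmxBl UU addrC subrK; congr determinant.
by apply/matrixP => a b; rewrite MU UM mxE.
Qed.

(** In the Leibniz formula, A records the rows from which the entry of M is taken; each remaining
    row contributes a diagonal factor a. *)
Lemma det_scalar_add (n : nat) (a : S) (M : 'M[S]_n) :
  \det (a%:M + M)
  = \sum_(A : {set 'I_n}) a ^+ (n - #|A|)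
      * \det (mxsub (@enum_val _ (mem A)) (@enum_val _ (mem A)) M).
Proof.
transitivity (\sum_(A : {set 'I_n})
    \det (\matrix_(i, j) (if i \in A then M i j else a * (i == j)%:R))).
  rewrite exchange_big /=; apply: eq_bigr => s _.
  rewrite -mulr_sumr; congr (_ * _).
  transitivity (\prod_i (M i (s i) + a * (i == s i)%:R)).
    by apply: eq_bigr => i _; rewrite !mxE addrC mulr_natr.
  rewrite bigA_distr; apply: eq_bigr => A _.
  by apply: eq_bigr => i _; rewrite mxE.
apply: eq_bigr => A _; rewrite -det_principal_minor.
pose d := \row_i (if i \in A then 1 else a).
have -> : \matrix_(i, j) (if i \in A then M i j else a * (i == j)%:R)
   = diag_mx d *m \matrix_(i, j) (if i \in A then M i j else (i == j)%:R).
  apply/matrixP => i j; rewrite mul_diag_mx !mxE; case: ifP => _ //.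
  by rewrite mul1r.
rewrite det_mulmx det_diag; congr (_ * _).
rewrite (eq_bigr (fun i => if i \in ~: A then a else 1)) => [|i _]; last first.
  by rewrite mxE inE; case: ifP.
by rewrite -big_mkcond /= prodr_const cardsCs setCK card_ord.
Qed.

End Determinants.

(** * Derivations of a commutative ring and matrix calculus *)

Section Derivations.
Variable S : comNzRingType.

(** A predicate on bare functions, so that it covers [mderiv], [deriv], [map_poly d] and
    combinations of derivations with ring coefficients alike. *)
Definition derivation (d : S -> S) : Prop :=
  {morph d : x y / x + y} /\ forall x y, d (x * y) = d x * y + x * d y.

Variables (d : S -> S) (der_d : derivation d).

Let dD : {morph d : x y / x + y} := der_d.1.
Let dM x y : d (x * y) = d x * y + x * d y := der_d.2 x y.

Lemma derivation0 : d 0 = 0.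
Proof. by apply: (@addrI _ (d 0)); rewrite -dD !addr0. Qed.

Lemma derivationN x : d (- x) = - d x.
Proof. by apply: (@addrI _ (d x)); rewrite -dD !subrr derivation0. Qed.

Lemma derivation1 : d 1 = 0.
Proof.
have /eqP := dM 1 1; rewrite !mulr1 mul1r -subr_eq subrr.
by rewrite eq_sym => /eqP.
Qed.

Lemma derivation_sum (I : Type) (r : seq I) (P : pred I) (E : I -> S) :
  d (\sum_(i <- r | P i) E i) = \sum_(i <- r | P i) d (E i).
Proof. exact: (big_morph d dD derivation0). Qed.

Lemma derivation_mx_mul p q r (A : 'M[S]_(p, q)) (B : 'M[S]_(q, r)) :
  map_mx d (A *m B) = map_mx d A *m B + A *m map_mx d B.
Proof.
apply/matrixP => i j; rewrite !mxE derivation_sum -big_split /=.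
by apply: eq_bigr => k _; rewrite dM !mxE.
Qed.

Lemma derivation_prod (I : finType) (E : I -> S) :
  d (\prod_i E i) = \sum_k \prod_i (if i == k then d (E i) else E i).
Proof.
transitivity (\sum_k d (E k) * \prod_(i | i != k) E i); last first.
  apply: eq_bigr => k _; rewrite [RHS](bigD1 k) //= eqxx; congr (_ * _).
  by apply: eq_bigr => i /negbTE->.
suff H (r : seq I) : uniq r -> d (\prod_(i <- r) E i)
   = \sum_(k <- r) d (E k) * \prod_(i <- r | i != k) E i.
  by rewrite H ?index_enum_uniq.
elim: r => [|x r IH] /=; first by rewrite !big_nil derivation1.
case/andP=> xr ur; rewrite !big_cons dM IH // eqxx /=.
congr (_ * _ + _).
  rewrite big_seq [RHS]big_seq_cond; apply: eq_bigl => i.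
  case: eqP => [->|]; last by rewrite andbT.
  by rewrite (negbTE xr).
rewrite mulr_sumr big_seq [RHS]big_seq; apply: eq_bigr => k kr.
rewrite big_cons; case: eqP => [xk|_]; first by rewrite xk kr in xr.
by rewrite mulrCA.
Qed.

(** Jacobi's formula. Differentiating row k and expanding along it pairs row k of dM with cofactors
    of M itself, since those cofactors omit the modified row. *)
Lemma derivation_det n (M : 'M[S]_n) :
  d (\det M) = \tr (\adj M *m map_mx d M).
Proof.
rewrite derivation_sum.
transitivity (\sum_k
    \det (\matrix_(i, j) (if i == k then d (M i j) else M i j))).
  rewrite exchange_big /=; apply: eq_bigr => s _.
  rewrite -mulr_sumr -[in LHS]signr_odd -[in RHS]signr_odd.
  have -> : d ((-1) ^+ odd s * \prod_i M i (s i))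
            = (-1) ^+ odd s * d (\prod_i M i (s i)).
    by case: (odd s); rewrite ?mulN1r ?mul1r // derivationN.
  congr (_ * _); rewrite derivation_prod; apply: eq_bigr => k _.
  by apply: eq_bigr => i _; rewrite mxE.
rewrite mxtrace_mulC; apply: eq_bigr => k _.
rewrite (expand_det_row _ k) mxE; apply: eq_bigr => l _.
rewrite !mxE eqxx; congr (_ * _); rewrite /cofactor; congr (_ * _).
congr determinant; apply/matrixP => i j; rewrite !mxE.
by rewrite eq_sym (negbTE (neq_lift _ _)).
Qed.

(* Differentiate M adj(M) = det M and multiply by adj(M) on the left. *)
Lemma derivation_adj n (M : 'M[S]_n) :
  \det M *: map_mx d (\adj M)
  = \tr (\adj M *m map_mx d M) *: \adj M - \adj M *m map_mx d M *m \adj M.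
Proof.
have := congr1 (map_mx d) (mul_mx_adj M); rewrite derivation_mx_mul => e.
have {}e : map_mx d M *m \adj M + M *m map_mx d (\adj M) = (d (\det M))%:M.
  rewrite e; apply/matrixP => i j; rewrite !mxE.
  by case: (i == j); rewrite // derivation0.
have := congr1 (mulmx (\adj M)) e.
rewrite mulmxDr !mulmxA mul_adj_mx mul_scalar_mx mul_mx_scalar derivation_det.
by move<-; rewrite addrC addKr.
Qed.

End Derivations.

Section DerivationExamples.
Variable S : comNzRingType.

Lemma derivation_map_poly (d : S -> S) :
  derivation d -> derivation (map_poly d).
Proof.
move=> dd; have d0 := derivation0 dd; split=> p q; apply/polyP => i.
  by rewrite coefD !coef_map_id0 // coefD dd.1.
rewrite coefD !coef_map_id0 // !coefM (derivation_sum dd) -big_split /=.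
by apply: eq_bigr => j _; rewrite dd.2 !coef_map_id0.
Qed.

Lemma derivation_map_polyC (d : S -> S) (c : S) :
  derivation d -> map_poly d c%:P = (d c)%:P.
Proof.
move=> dd; apply/polyP => i; rewrite coef_map_id0 ?(derivation0 dd) // !coefC.
by case: eqP; rewrite ?(derivation0 dd).
Qed.

Lemma derivation_map_polyX (d : S -> S) : derivation d -> map_poly d 'X = 0.
Proof.
move=> dd; apply/polyP => i; rewrite coef_map_id0 ?(derivation0 dd) // coefX.
by rewrite coef0; case: eqP; rewrite ?(derivation0 dd) ?(derivation1 dd).
Qed.

Lemma derivation_deriv : derivation (@deriv S).
Proof. by split=> p q; rewrite ?derivD ?derivM. Qed.

Lemma derivation_mderiv k (i : 'I_k) : derivation (@mderiv k S i).
Proof. by split=> p q; rewrite ?mderivD ?mderivM. Qed.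

Lemma mderiv_mvar k (i j : 'I_k) : mderiv i ('X_j : {mpoly S[k]}) = (j == i)%:R.
Proof.
rewrite mderivX mnm1E; case: eqP => [->|_]; last by rewrite scale0r.
by rewrite -{1}[U_(i)%MM]add0m addmK mpolyX0 scale1r.
Qed.

(** Needed for the derivative in the direction [A, Y], whose components depend on Y. *)
Lemma derivation_lincomb (I : finType) (d : I -> S -> S) (c : I -> S) :
  (forall i, derivation (d i)) -> derivation (fun x => \sum_i d i x * c i).
Proof.
move=> dd; split=> x y.
  by rewrite -big_split /=; apply: eq_bigr => i _; rewrite (dd i).1 mulrDl.
rewrite mulr_suml mulr_sumr -big_split /=; apply: eq_bigr => i _.
by rewrite (dd i).2 mulrDl mulrAC mulrA.
Qed.

Lemma derivation_map_scalar n (d : S -> S) (a : S) : derivation d ->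
  map_mx d (a%:M : 'M_n) = (d a)%:M.
Proof.
move=> dd; apply/matrixP => i j; rewrite !mxE.
by case: (i == j); rewrite // (derivation0 dd).
Qed.

End DerivationExamples.

(** * Derivatives of the adjugate in coordinate directions *)

Section AdjugateDerivatives.
Variables (S : idomainType) (n : nat) (M : 'M[S]_n).
Hypothesis detM : \det M != 0.

(** The right-hand side is a 2 x 2 minor of adj M, on rows i, k and columns j, l; hence it changes
    sign when i and k are exchanged. *)
Lemma derivation_delta_adj (d : S -> S) (i j k l : 'I_n) :
  derivation d -> map_mx d M = delta_mx j i ->
  \det M * d (\adj M k l)
  = \adj M i j * \adj M k l - \adj M k j * \adj M i l.
Proof.
move=> dd dM; have := derivation_adj dd M; rewrite dM.
have aE q s : (\adj M *m delta_mx j i) q s = \adj M q j * (s == i)%:R.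
  rewrite mxE (bigD1 j) //= big1 ?addr0 => [|r nr]; rewrite [X in _ * X]mxE.
    by rewrite eqxx.
  by rewrite (negbTE nr) mulr0.
move/matrixP/(_ k l); rewrite mxE [X in _ * X]mxE => ->.
rewrite mxE [X in X + _]mxE [X in _ + X]mxE [X in - X]mxE.
congr (_ * _ - _).
  rewrite /mxtrace (bigD1 i) //= big1 ?addr0 => [|q nq]; rewrite aE.
    by rewrite eqxx mulr1.
  by rewrite (negbTE nq) mulr0.
rewrite (bigD1 i) //= big1 ?addr0 => [|q nq]; rewrite aE.
  by rewrite eqxx mulr1.
by rewrite (negbTE nq) mulr0 mul0r.
Qed.

Lemma derivation_adj_antisym (d d' : S -> S) (i j k l : 'I_n) :
  derivation d -> map_mx d M = delta_mx j i ->
  derivation d' -> map_mx d' M = delta_mx j k ->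
  d (\adj M k l) = - d' (\adj M i l).
Proof.
move=> dd dM dd' dM'; apply: (mulfI detM); rewrite mulrN.
rewrite (derivation_delta_adj _ _ dd dM) (derivation_delta_adj _ _ dd' dM').
by rewrite opprB.
Qed.

(** Summing the minors above over l = i gives the (k, j) entry of (adj M)^2 - tr(adj M) adj M, which
    is minus det M times the derivative of adj M in the direction of the identity. *)
Lemma sum_derivation_adj (d : 'I_n -> S -> S) (d1 : S -> S) (j k : 'I_n) :
  (forall i, derivation (d i)) -> (forall i, map_mx (d i) M = delta_mx j i) ->
  derivation d1 -> map_mx d1 M = 1%:M ->
  \sum_i d i (\adj M k i) = - d1 (\adj M k j).
Proof.
move=> dd dM dd1 dM1; apply: (mulfI detM); rewrite mulrN.
have := derivation_adj dd1 M => /matrixP/(_ k j).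
rewrite dM1 mulmx1 mxE [X in _ * X]mxE => ->.
rewrite mxE [X in X + _]mxE [X in _ + X]mxE opprB mulr_sumr mxE.
rewrite (eq_bigr _ (fun i _ => derivation_delta_adj k i (dd i) (dM i))).
rewrite sumrB; congr (_ - _); first by apply: eq_bigr => i _; rewrite mulrC.
by rewrite -mulr_sumr mulrC.
Qed.

End AdjugateDerivatives.

(** * The Kirillov-Wei operator on characteristic coefficients *)

Section GenericMatrix.
Variables (S : idomainType) (n : nat) (Y : 'M[S]_n).

Definition shifted_mx : 'M[{poly S}]_n := 'X%:M + map_mx polyC Y.
Local Notation M := shifted_mx.

Definition adj_coef (p : nat) : 'M[S]_n := \matrix_(i, j) (\adj M i j)`_p.

(** This is [char_coef] with an arbitrary matrix over a domain in place of the generic one, so that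
    evaluation and restriction can be pushed into the matrix. *)
Definition minor_sum (k : nat) : S :=
  \sum_(A : {set 'I_n} | #|A| == k)
     \det (mxsub (@enum_val _ (mem A)) (@enum_val _ (mem A)) Y).

Lemma det_shifted_mx_neq0 : \det M != 0.
Proof.
suff -> : \det M = char_poly (- Y) by exact/monic_neq0/char_poly_monic.
by congr determinant; rewrite /char_poly_mx map_mxN opprK.
Qed.

Lemma coef_det_shifted_mx k : (k <= n)%N -> (\det M)`_(n - k) = minor_sum k.
Proof.
move=> kn; rewrite det_scalar_add coef_sum [RHS]big_mkcond /=.
apply: eq_bigr => A _; have An : (#|A| <= n)%N.
  by rewrite -[X in (_ <= X)%N]card_ord max_card.
rewrite -map_mxsub det_map_mx mulrC coefCM coefXn eqn_sub2lE // eq_sym.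
by case: eqP; rewrite ?mulr1 ?mulr0.
Qed.

Lemma derivation_shifted_mx (d : S -> S) : derivation d ->
  map_mx (map_poly d) M = map_mx polyC (map_mx d Y).
Proof.
move=> dd; have ddp := derivation_map_poly dd; apply/matrixP => i j.
rewrite !mxE ddp.1 derivation_map_polyC //.
by case: (i == j); rewrite ?(derivation0 ddp) ?derivation_map_polyX ?add0r.
Qed.

Lemma deriv_shifted_mx : map_mx deriv M = 1%:M.
Proof.
apply/matrixP => i j; rewrite !mxE derivD derivC addr0.
by rewrite derivMn derivX.
Qed.

(** By Jacobi's formula the derivative of det M is tr(adj M [A, M]), which vanishes by cyclicity of
    the trace because both products of M and adj M equal the same scalar matrix. *)
Lemma minor_sum_conj_invariant (d : S -> S) (A : 'M[S]_n) k : (k <= n)%N ->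
  derivation d -> map_mx d Y = A *m Y - Y *m A -> d (minor_sum k) = 0.
Proof.
move=> kn dd dY; rewrite -coef_det_shifted_mx //.
rewrite -coef_map_id0 ?(derivation0 dd) //.
rewrite (derivation_det (derivation_map_poly dd)) derivation_shifted_mx // dY.
set B := map_mx polyC A.
(* The scalar matrix X is central, so [A, Y] = [A, M]. *)
have -> : map_mx polyC (A *m Y - Y *m A) = B *m M - M *m B.
  have -> : map_mx polyC (A *m Y - Y *m A)
            = B *m map_mx polyC Y - map_mx polyC Y *m B.
    by rewrite -!map_mxM -map_mxB.
  have key (V : zmodType) (a b c : V) : b - c = (a + b) - (a + c).
    by rewrite opprD addrACA subrr add0r.
  by rewrite mulmxDr mulmxDl scalar_mxC; apply: key.
rewrite mulmxBr linearB /= mulmxA mxtrace_mulC mulmxA mul_mx_adj.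
by rewrite mulmxA mul_adj_mx subrr coef0.
Qed.

Variable D : 'I_n -> 'I_n -> S -> S.
Hypothesis derD : forall i j, derivation (D i j).
Hypothesis DY : forall i j, map_mx (D i j) Y = delta_mx i j.

Let derDp i j := derivation_map_poly (derD i j).

Let DM i j : map_mx (map_poly (D i j)) M = delta_mx i j.
Proof. by rewrite derivation_shifted_mx // DY map_delta_mx. Qed.

Lemma gradient_minor_sum i j k : (k <= n)%N ->
  D i j (minor_sum k) = adj_coef (n - k) j i.
Proof.
move=> kn; rewrite -coef_det_shifted_mx //.
rewrite -coef_map_id0 ?(derivation0 (derD i j)) //.
rewrite (derivation_det (derDp i j)) DM mxE.
congr (_`__); rewrite /mxtrace (bigD1 j) //= big1 ?addr0 => [|l nl].
  rewrite mxE (bigD1 i) //= big1 ?addr0 => [|l nl];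
    rewrite !mxE ?eqxx ?mulr1 //.
  by rewrite (negbTE nl) mulr0.
by rewrite mxE big1 // => q _; rewrite [X in _ * X]mxE (negbTE nl) andbF mulr0.
Qed.

Lemma D_adj_coef i j p k l :
  D i j (adj_coef p k l) = (map_poly (D i j) (\adj M k l))`_p.
Proof. by rewrite mxE coef_map_id0 ?(derivation0 (derD i j)). Qed.

Lemma D_adj_coef_antisym p i j k l :
  D j i (adj_coef p k l) = - D j k (adj_coef p i l).
Proof.
by rewrite !D_adj_coef -coefN
  (derivation_adj_antisym det_shifted_mx_neq0 l (derDp j i) (DM j i)
    (derDp j k) (DM j k)).
Qed.

(** Since M = X + Y, the derivative in the direction of the identity is realised by d/dX, whose
    coefficient at X^p is p + 1 times the next coefficient. *)
Lemma sum_D_adj_coef p j k :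
  \sum_i D j i (adj_coef p k i) = - (adj_coef p.+1 k j *+ p.+1).
Proof.
have e := sum_derivation_adj det_shifted_mx_neq0 k (derDp j) (DM j)
  (derivation_deriv _) deriv_shifted_mx.
have := congr1 (fun r : {poly _} => r`_p) e.
rewrite coefN coef_deriv [adj_coef _ _ _]mxE => <-.
by rewrite coef_sum; apply: eq_bigr => i _; rewrite D_adj_coef.
Qed.

Hypothesis two_neq0 : 2%:R != 0 :> S.
Variables (N : nat) (e : 'I_n -> 'I_n -> 'M[S]_N).
Hypothesis De : forall i j k l, map_mx (D i j) (e k l) = 0.
(** For e_kl = x_k d/dx_l both sides are the normally ordered product x_k x_i d^2/(dx_l dx_j). *)
Hypothesis normal_order : forall i j k l,
  e k l *m e i j - (l == i)%:R *: e k j = e i l *m e k j - (l == k)%:R *: e i j.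

Definition pi_mx (G : 'M[S]_n) : 'M[S]_N := \sum_i \sum_j G i j *: e i j.

Definition kirillov_wei (F : 'M[S]_N) : 'M[S]_N :=
  \sum_i \sum_j map_mx (D j i) F *m e i j.

Lemma kirillov_wei_minor_sum k : (k <= n)%N ->
  kirillov_wei (minor_sum k)%:M = pi_mx (adj_coef (n - k)).
Proof.
move=> kn; apply: eq_bigr => i _; apply: eq_bigr => j _.
by rewrite derivation_map_scalar // mul_scalar_mx gradient_minor_sum.
Qed.

(* By antisymmetry of D_ji adj_kl in (i, k), only the contraction of the product
   e_kl e_ij survives, not its normally ordered part. *)
Lemma kirillov_wei_pi_adj_coef p :
  kirillov_wei (pi_mx (adj_coef p))
  = - (p.+1%:R : S) *: pi_mx (adj_coef p.+1).
Proof.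
pose c i j k l := D j i (adj_coef p k l).
have -> : kirillov_wei (pi_mx (adj_coef p))
    = \sum_j \sum_l \sum_i \sum_k c i j k l *: (e k l *m e i j).
  rewrite /kirillov_wei exchange_big; apply: eq_bigr => j _.
  rewrite exchange_big; apply: eq_bigr => i _ /=.
  have -> : map_mx (D j i) (pi_mx (adj_coef p))
            = \sum_k \sum_l c i j k l *: e k l.
    apply/matrixP => a b; rewrite mxE !summxE (derivation_sum (derD j i)).
    apply: eq_bigr => k _; rewrite !summxE (derivation_sum (derD j i)).
    apply: eq_bigr => l _; rewrite [X in D j i X]mxE [RHS]mxE (derD j i).2.
    have /matrixP/(_ a b) := De j i k l; rewrite mxE [RHS]mxE => ->.
    by rewrite mulr0 addr0.
  rewrite exchange_big mulmx_suml; apply: eq_bigr => l _ /=.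
  by rewrite mulmx_suml; apply: eq_bigr => k _; rewrite scalemxAl.
(* The normally ordered part of e_kl e_ij is symmetric in i and k; paired with the antisymmetric
   coefficients c it sums to zero. *)
pose v i j k l := e k l *m e i j - (l == i)%:R *: e k j.
have vE i j k l : e k l *m e i j = v i j k l + (l == i)%:R *: e k j.
  by rewrite subrK.
have antisym0 (f : 'I_n -> 'I_n -> S) (w : 'I_n -> 'I_n -> 'M[S]_N) :
    (forall i k, f i k = - f k i) -> (forall i k, w i k = w k i) ->
    \sum_i \sum_k f i k *: w i k = 0.
  move=> fN wC; set T := \sum_i _.
  have TN : T = - T.
    rewrite {1}/T exchange_big -sumrN; apply: eq_bigr => i _ /=.
    rewrite -sumrN; apply: eq_bigr => k _.
    by rewrite fN wC scaleNr.
  apply/matrixP => a b; rewrite [RHS]mxE; have /matrixP/(_ a b) := TN.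
  rewrite [RHS]mxE => Tab; apply: (mulfI two_neq0).
  by rewrite mulr0 mulr_natl mulr2n {2}Tab subrr.
(* What remains is the contraction l = i, which [sum_D_adj_coef] evaluates. *)
transitivity (\sum_j \sum_k (\sum_i c i j k i) *: e k j).
  apply: eq_bigr => j _.
  rewrite [RHS](eq_bigr (fun k => \sum_l \sum_i
                           c i j k l *: ((l == i)%:R *: e k j))); last first.
    move=> k _; rewrite scaler_suml; apply: eq_bigr => l _.
    rewrite (bigD1 l) //= eqxx scale1r big1 ?addr0 // => i /negbTE il.
    by rewrite eq_sym il scale0r scaler0.
  rewrite [RHS]exchange_big /=; apply: eq_bigr => l _.
  rewrite [RHS]exchange_big /=; apply/eqP; rewrite -subr_eq0 -sumrB.
  under eq_bigr => i _ do
    (rewrite -sumrB; under eq_bigr => k _ do rewrite -scalerBr).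
  apply/eqP; apply: antisym0 => i k; last exact: normal_order.
  exact: D_adj_coef_antisym.
rewrite /pi_mx scaler_sumr exchange_big; apply: eq_bigr => k _ /=.
rewrite scaler_sumr; apply: eq_bigr => j _; rewrite sum_D_adj_coef.
by rewrite scalerA mulNr mulr_natl.
Qed.

(** Every derivation kills the integers, and only integer factors arise when the operator is
    iterated. *)
Lemma kirillov_weiZ z F : kirillov_wei (z%:~R *: F) = z%:~R *: kirillov_wei F.
Proof.
have Dnat i j k : D i j k%:R = 0.
  elim: k => [|k IH]; first exact: derivation0.
  by rewrite -natr1 (derD i j).1 IH add0r derivation1.
have Dz i j : D i j z%:~R = 0.
  by case: z => k; rewrite ?NegzE ?mulrNz ?(derivationN (derD i j)) Dnat ?oppr0.
rewrite /kirillov_wei scaler_sumr; apply: eq_bigr => i _.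
rewrite scaler_sumr; apply: eq_bigr => j _; rewrite scalemxAl; congr (_ *m _).
by apply/matrixP => a b; rewrite !mxE (derD j i).2 Dz mul0r add0r.
Qed.

(** The first application turns c_k into pi(A_(n-k)); each later one raises the index by one and
    multiplies by an integer. *)
Lemma iter_kirillov_wei_minor_sum q k : (k <= n)%N ->
  exists z : int, exists r, iter q.+1 kirillov_wei (minor_sum k)%:M
                            = z%:~R *: pi_mx (adj_coef r).
Proof.
move=> kn; elim: q => [|q [z [r IH]]].
  by exists 1, (n - k)%N; rewrite scale1r /= kirillov_wei_minor_sum.
exists (z * - (r.+1%:Z)), r.+1.
rewrite iterS IH kirillov_weiZ kirillov_wei_pi_adj_coef scalerA.
by rewrite intrM mulrNz.
Qed.

End GenericMatrix.

(** * Symmetric powers *)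

(** Suited to comparing algebra homomorphisms, or derivations along them, which are determined by
    the variables. *)
Lemma mpoly_alg_ind (S : comNzRingType) (k : nat) (P : {mpoly S[k]} -> Prop) :
  (forall c, P c%:MP) -> (forall i, P 'X_i) ->
  (forall p q, P p -> P q -> P (p + q)) ->
  (forall p q, P p -> P q -> P (p * q)) -> forall p, P p.
Proof.
move=> PC PX PD PM p; rewrite [p]mpolyE.
apply: (big_ind P); [by rewrite -mpolyC0 | exact: PD | move=> a _].
rewrite -mul_mpolyC; apply: (PM) => //; rewrite mpolyXE_id.
apply: (big_ind P); [by rewrite -mpolyC1 | exact: PM | move=> i _].
by elim: (a i) => [|d IH]; rewrite ?expr0 -?mpolyC1 // exprS; apply: PM.
Qed.

Section LinearSubstitutions.
Variables (K : comNzRingType) (n : nat).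
Local Notation Sh := {mpoly K[n]}.

Lemma linear_combE (T : Sh -> Sh) : linear T ->
  forall (I : finType) (c : I -> K) (v : I -> Sh),
  T (\sum_i c i *: v i) = \sum_i c i *: T (v i).
Proof.
move=> Tl I c v; have T0 : T 0 = 0.
  have := Tl (-1) 0 0; rewrite scaler0 add0r => {1}->.
  by rewrite scaleN1r addNr.
have TD x y : T (x + y) = T x + T y by have := Tl 1 x y; rewrite !scale1r.
rewrite (big_morph T TD T0); apply: eq_bigr => i _.
by have := Tl (c i) (v i) 0; rewrite T0 !addr0.
Qed.

(** The operator inside [pi_gl], on the whole polynomial ring; [subst_mx] below is likewise the one
    inside [rho]. Identities are proved there and then cut down to degree m. *)
Definition dl (A : 'M[K]_n) (p : Sh) : Sh :=
  \sum_i \sum_j A i j *: ('X_i * mderiv j p).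

Lemma dl_derivation A : derivation (dl A).
Proof.
split=> p q; rewrite /dl.
  rewrite -big_split; apply: eq_bigr => i _ /=; rewrite -big_split.
  by apply: eq_bigr => j _ /=; rewrite mderivD mulrDr scalerDr.
rewrite mulr_suml mulr_sumr -big_split; apply: eq_bigr => i _ /=.
rewrite mulr_suml mulr_sumr -big_split; apply: eq_bigr => j _ /=.
rewrite mderivM mulrDr scalerDr -scalerAl -scalerAr !mulrA.
by rewrite ['X_i * p]mulrC.
Qed.

Lemma dlC A c : dl A c%:MP = 0.
Proof.
by apply: big1 => i _; apply: big1 => j _; rewrite mderivC mulr0 scaler0.
Qed.

Lemma dl_mvar A j : dl A 'X_j = \sum_i A i j *: 'X_i.
Proof.
apply: eq_bigr => i _; rewrite (bigD1 j) //= big1 => [|k kj].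
  by rewrite mderiv_mvar eqxx mulr1 addr0.
by rewrite mderiv_mvar eq_sym (negbTE kj) mulr0 scaler0.
Qed.

Lemma dl_linear A : linear (dl A).
Proof.
move=> c p q; rewrite (dl_derivation A).1 -mul_mpolyC (dl_derivation A).2 dlC.
by rewrite mul0r add0r mul_mpolyC.
Qed.

Lemma dl_delta i j p : dl (delta_mx i j) p = 'X_i * mderiv j p.
Proof.
rewrite /dl (bigD1 i) //= (bigD1 j) //= !big1 => [||k kj].
- by rewrite mxE !eqxx scale1r !addr0.
- move=> k ki; rewrite big1 // => l _.
  by rewrite mxE (negbTE ki) scale0r.
- by rewrite mxE (negbTE kj) andbF scale0r.
Qed.

(** By Leibniz, the subtracted contraction is the term in which d/dx_l hits the factor x_i. *)
Lemma dl_comp_delta i j k l p :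
  dl (delta_mx k l) (dl (delta_mx i j) p) - (l == i)%:R *: dl (delta_mx k j) p
  = 'X_k * ('X_i * mderiv l (mderiv j p)).
Proof.
rewrite !dl_delta mderivM mderiv_mvar mulrDr eq_sym.
case: (l == i); first by rewrite mul1r scale1r addrAC subrr add0r.
by rewrite mul0r mulr0 add0r scale0r subr0.
Qed.

Definition subst_mx (g : 'M[K]_n) (p : Sh) : Sh :=
  p \mPo [tuple \sum_i g i j *: 'X_i | j < n].

Lemma subst_mxC g c : subst_mx g c%:MP = c%:MP.
Proof. exact: comp_mpolyC. Qed.

Lemma subst_mx0 g : subst_mx g 0 = 0.
Proof. exact: comp_mpoly0. Qed.

Lemma subst_mxD g p q : subst_mx g (p + q) = subst_mx g p + subst_mx g q.
Proof. exact: comp_mpolyD. Qed.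

Lemma subst_mx1 p : subst_mx 1%:M p = p.
Proof.
rewrite /subst_mx.
have -> : [tuple \sum_i (1%:M : 'M[K]_n) i j *: 'X_i | j < n]
          = [tuple 'X_j | j < n] :> n.-tuple Sh.
  apply: eq_mktuple => j; rewrite (bigD1 j) //= big1 => [|i ij].
    by rewrite mxE eqxx scale1r addr0.
  by rewrite mxE (negbTE ij) scale0r.
exact: comp_mpoly_id.
Qed.

Lemma subst_mx_mvar g j : subst_mx g 'X_j = \sum_i g i j *: 'X_i.
Proof. by rewrite /subst_mx comp_mpolyXU -tnth_nth tnth_mktuple. Qed.

Lemma subst_mx_linear g : linear (subst_mx g).
Proof. by move=> c p q; rewrite /subst_mx comp_mpolyD comp_mpolyZ. Qed.

Lemma subst_mxM g p q : subst_mx g (p * q) = subst_mx g p * subst_mx g q.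
Proof. by rewrite /subst_mx rmorphM. Qed.

Lemma subst_mx_comp g h p : subst_mx g (subst_mx h p) = subst_mx (g *m h) p.
Proof.
elim/mpoly_alg_ind: p => [c|j|p q hp hq|p q hp hq].
- by rewrite !subst_mxC.
- rewrite !subst_mx_mvar (linear_combE (@subst_mx_linear g)).
  under eq_bigr => i _ do rewrite subst_mx_mvar scaler_sumr.
  rewrite exchange_big; apply: eq_bigr => i _ /=; rewrite mxE scaler_suml.
  by apply: eq_bigr => k _; rewrite scalerA mulrC.
- by rewrite !subst_mxD hp hq.
- by rewrite !subst_mxM hp hq.
Qed.

(** Both sides are derivations along the homomorphism [subst_mx g], so it is enough to compare them
    on the variables, where equality is g A = B g. *)
Lemma subst_mx_dl g A B p : g *m A = B *m g ->
  subst_mx g (dl A p) = dl B (subst_mx g p).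
Proof.
move=> gA; elim/mpoly_alg_ind: p => [c|j|p q hp hq|p q hp hq].
- by rewrite dlC subst_mx0 subst_mxC dlC.
- rewrite dl_mvar subst_mx_mvar (linear_combE (@subst_mx_linear g)).
  rewrite (linear_combE (@dl_linear B)).
  under eq_bigr => i _ do rewrite subst_mx_mvar scaler_sumr.
  under [RHS]eq_bigr => i _ do rewrite dl_mvar scaler_sumr.
  rewrite exchange_big [RHS]exchange_big; apply: eq_bigr => i _ /=.
  have /matrixP/(_ i j) := gA; rewrite !mxE => gAij.
  under eq_bigr => k _ do rewrite scalerA mulrC.
  under [RHS]eq_bigr => k _ do rewrite scalerA mulrC.
  by rewrite -!scaler_suml gAij.
- by rewrite (dl_derivation A).1 !subst_mxD hp hq (dl_derivation B).1.
- rewrite (dl_derivation A).2 subst_mxD !subst_mxM hp hq.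
  by rewrite (dl_derivation B).2.
Qed.

End LinearSubstitutions.

(** * Matrices of operators on the degree m polynomials *)

Section SymmetricPower.
Variables (R : realType) (n m : nat).
Local Notation C := (complex R).
Local Notation Sh := {mpoly C[n]}.
Local Notation weight := (weight n m).
Local Notation N := #|{: weight}|.
Local Notation op_mx := (@op_mx R n m).
Local Notation basis_mnm := (@basis_mnm n m).

Lemma mdeg_weight_mnm (mu : weight) : mdeg (weight_mnm mu) = m.
Proof. exact/eqP/(valP mu). Qed.

Lemma mdeg_basis_mnm b : mdeg (basis_mnm b) = m.
Proof. exact: mdeg_weight_mnm. Qed.

Lemma weight_mnm_inj : injective (@weight_mnm n m).
Proof. by move=> mu nu /val_inj/val_inj. Qed.

Lemma basis_mnm_inj : injective basis_mnm.
Proof. by move=> a b /weight_mnm_inj/enum_val_inj. Qed.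

Lemma basis_mnm_surj (x : 'X_{1..n}) : mdeg x = m -> exists b, basis_mnm b = x.
Proof.
move=> xm; have xb : (mdeg x < m.+1)%N by rewrite xm.
have xe : mdeg (BMultinom xb) == m by rewrite /= xm.
exists (enum_rank (exist _ (BMultinom xb) xe : weight)).
by rewrite /basis_mnm enum_rankK.
Qed.

Lemma homog_basis_expand (p : Sh) : p \is m.-homog ->
  p = \sum_b p@_(basis_mnm b) *: 'X_[basis_mnm b].
Proof.
move=> ph; apply/mpolyP => x; rewrite raddf_sum /=.
under eq_bigr => b _ do rewrite mcoeffZ mcoeffX.
case: (eqVneq (mdeg x) m) => [xm | xm]; last first.
  rewrite (dhomog_nemf_coeff ph) // big1 // => b _.
  case: eqP => [bx|_]; last by rewrite mulr0.
  by rewrite -bx mdeg_basis_mnm eqxx in xm.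
have [a <-] := basis_mnm_surj xm.
rewrite (bigD1 a) //= eqxx mulr1 big1 ?addr0 // => b /negbTE ba.
by rewrite (inj_eq basis_mnm_inj) ba mulr0.
Qed.

(** [op_mx] records only coefficients of degree m, so the images under U must be recoverable from
    those coefficients. *)
Lemma op_mx_comp (T U : Sh -> Sh) : linear T ->
  (forall b, U 'X_[basis_mnm b] \is m.-homog) ->
  op_mx T *m op_mx U = op_mx (fun p => T (U p)).
Proof.
move=> Tl Uh; apply/matrixP => a b; rewrite !mxE.
rewrite [in RHS](homog_basis_expand (Uh b)) (linear_combE Tl) raddf_sum /=.
by apply: eq_bigr => c _; rewrite mcoeffZ !mxE mulrC.
Qed.

Lemma eq_op_mx (T U : Sh -> Sh) : T =1 U -> op_mx T = op_mx U.
Proof. by move=> e; apply/matrixP => a b; rewrite !mxE e. Qed.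

Lemma dl_homog (A : 'M[C]_n) (p : Sh) : p \is m.-homog -> dl A p \is m.-homog.
Proof.
move=> ph; rewrite (homog_basis_expand ph) (linear_combE (dl_linear A)).
apply: rpred_sum => b _; apply: rpredZ.
apply: rpred_sum => i _; apply: rpred_sum => j _; apply: rpredZ.
rewrite mderivX -scalerAr -mpolyXD.
(* Exponents subtract with truncation; when x_j is absent the coefficient 0 removes the term. *)
case: (posnP (basis_mnm b j)) => [->|jb]; first by rewrite scale0r rpred0.
have le1 : (U_(j) <= basis_mnm b)%MM by rewrite lep1mP -lt0n.
have := congr1 mdeg (submK le1); rewrite mdegD mdeg1 mdeg_basis_mnm => e.
by apply: rpredZ; rewrite dhomogX /= mdegD mdeg1 addnC e.
Qed.

Lemma pi_glE (A : 'M[C]_n) : @pi_gl R n m A = op_mx (dl A). Proof. by []. Qed.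

Lemma rhoE (g : 'M[C]_n) : @rho R n m g = op_mx (subst_mx g). Proof. by []. Qed.

Lemma subst_mx_homog (g : 'M[C]_n) (p : Sh) :
  p \is m.-homog -> subst_mx g p \is m.-homog.
Proof.
move=> ph; rewrite (homog_basis_expand ph) (linear_combE (subst_mx_linear g)).
apply: rpred_sum => b _; apply: rpredZ.
rewrite /subst_mx comp_mpolyX.
set q := \prod_(i < n) _; suff: q \is (mdeg (basis_mnm b)).-homog.
  by rewrite mdeg_basis_mnm.
rewrite mdegE; apply: (big_ind2 (fun p d => p \is [in C[n], d.-homog])).
- exact: dhomog1.
- by move=> ? ? ? ?; apply: dhomogM.
move=> i _; rewrite tnth_mktuple.
suff lin : \sum_j g j i *: 'X_j \is [in C[n], 1.-homog].
  by have := dhomogMn (basis_mnm b i) lin; rewrite mul1n.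
by apply: rpred_sum => j _; apply: rpredZ; rewrite dhomogX /= mdeg1.
Qed.

Lemma homogX b : 'X_[basis_mnm b] \is [in C[n], m.-homog].
Proof. by rewrite dhomogX /= mdeg_basis_mnm. Qed.

Lemma rho_pi_gl (g A B : 'M[C]_n) : g *m A = B *m g ->
  @rho R n m g *m @pi_gl R n m A = @pi_gl R n m B *m @rho R n m g.
Proof.
move=> gA; rewrite !rhoE !pi_glE !op_mx_comp.
- by apply: eq_op_mx => p; apply: subst_mx_dl.
- exact: dl_linear.
- by move=> b; apply/subst_mx_homog/homogX.
- exact: subst_mx_linear.
- by move=> b; apply/dl_homog/homogX.
Qed.

Lemma rho_unitmx (g : 'M[C]_n) : g \in unitmx -> @rho R n m g \in unitmx.
Proof.
move=> gu; suff e : @rho R n m g *m @rho R n m (invmx g) = 1%:M.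
  have [h _] := mulmx1_unit e.
  exact: h.
rewrite !rhoE op_mx_comp; last 2 first.
- exact: subst_mx_linear.
- by move=> b; apply/subst_mx_homog/homogX.
apply/matrixP => a b; rewrite mxE subst_mx_comp mulmxV // subst_mx1.
by rewrite mcoeffX (inj_eq basis_mnm_inj) mxE eq_sym.
Qed.

Lemma pi_gl_sum A :
  @pi_gl R n m A = \sum_i \sum_j A i j *: @pi_gl R n m (delta_mx i j).
Proof.
apply/matrixP => a b; rewrite mxE raddf_sum /= summxE; apply: eq_bigr => i _.
rewrite raddf_sum /= summxE; apply: eq_bigr => j _.
by rewrite !mxE mcoeffZ -/(dl (delta_mx i j) _) dl_delta.
Qed.

(* Normal ordering of the operators x_k d/dx_l and x_i d/dx_j: the difference
   below is x_k x_i d^2/(dx_l dx_j), which is symmetric in i and k. *)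
Lemma pi_gl_normal_order i j k l :
  @pi_gl R n m (delta_mx k l) *m @pi_gl R n m (delta_mx i j)
    - (l == i)%:R *: @pi_gl R n m (delta_mx k j)
  = @pi_gl R n m (delta_mx i l) *m @pi_gl R n m (delta_mx k j)
    - (l == k)%:R *: @pi_gl R n m (delta_mx i j) :> 'M[C]_N.
Proof.
have H i' k' : @pi_gl R n m (delta_mx k' l) *m @pi_gl R n m (delta_mx i' j)
    - (l == i')%:R *: @pi_gl R n m (delta_mx k' j)
    = op_mx (fun p => 'X_k' * ('X_i' * mderiv l (mderiv j p))) :> 'M[C]_N.
  rewrite !pi_glE op_mx_comp; last 2 first.
  - exact: dl_linear.
  - by move=> b; apply/dl_homog/homogX.
  by apply/matrixP => a b; rewrite !mxE -dl_comp_delta mcoeffB mcoeffZ.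
rewrite !H; apply: eq_op_mx => p.
by rewrite mulrCA.
Qed.

End SymmetricPower.

(** * Polynomial identities *)

(** In characteristic zero the integers below the size of p would be too many roots. *)
Lemma poly_eq0_horner (K : numDomainType) (p : {poly K}) :
  (forall x, p.[x] = 0) -> p = 0.
Proof.
move=> p0; apply/eqP; apply: contraT => pn0.
have := @max_poly_roots _ p [seq i%:R | i <- iota 0 (size p)] pn0.
rewrite size_map size_iota ltnn; apply.
  by apply/allP => x _; rewrite rootE p0.
by rewrite map_inj_uniq ?iota_uniq //; move=> i j /eqP; rewrite eqr_nat => /eqP.
Qed.

Lemma digits_inj (B k : nat) (f g : 'I_k -> nat) :
  (forall i, f i < B)%N -> (forall i, g i < B)%N ->
  (\sum_i f i * B ^ i)%N = (\sum_i g i * B ^ i)%N -> f =1 g.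
Proof.
elim: k f g => [|k IH] f g fB gB; first by move=> _ [].
have split_sum (h : 'I_k.+1 -> nat) : (\sum_i h i * B ^ i)%N
    = ((\sum_i h (lift ord0 i) * B ^ i) * B + h ord0)%N.
  rewrite big_ord_recl expn0 muln1 addnC; congr (_ + _)%N.
  by rewrite big_distrl; apply: eq_bigr => i _ /=; rewrite -mulnA -expnSr.
rewrite !split_sum => e.
have B0 : (0 < B)%N by apply: leq_ltn_trans (fB ord0).
have e0 : f ord0 = g ord0.
  by have := congr1 (modn^~ B) e; rewrite !modnMDl !modn_small.
move: e; rewrite e0 => /addIn/eqP; rewrite eqn_pmul2r // => /eqP e i.
case: (unliftP ord0 i) => [j ->|-> //].
exact: (IH (fun i => f (lift ord0 i)) (fun i => g (lift ord0 i))).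
Qed.

(* Kronecker substitution x_i = t^(B^i), with B larger than all exponents. *)
Lemma mpoly_eq0_meval (K : numDomainType) (k : nat) (p : {mpoly K[k]}) :
  (forall v, p.@[v] = 0) -> p = 0.
Proof.
move=> p0; pose B := msize p.
pose code (a : 'X_{1..k}) := (\sum_i a i * B ^ i)%N.
have aB a i : a \in msupp p -> (a i < B)%N.
  move=> /msize_mdeg_lt; apply: leq_ltn_trans.
  by rewrite mdegE (bigD1 i) //= leq_addr.
pose q : {poly K} := \sum_(a <- msupp p) p@_a *: 'X^(code a).
have q0 : q = 0.
  apply: poly_eq0_horner => t; rewrite -(p0 (fun i => t ^+ (B ^ i))) mevalE.
  rewrite horner_sum; apply: eq_bigr => a _; rewrite hornerZ hornerXn.
  congr (_ * _); rewrite -prodrXr; apply: eq_bigr => i _.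
  by rewrite -exprM mulnC.
apply/mpolyP => a; rewrite mcoeff0; case: (boolP (a \in msupp p)) => [ap|].
  have := congr1 (fun r : {poly _} => r`_(code a)) q0.
  rewrite coef0 coef_sum (bigD1_seq a) //= ?msupp_uniq //.
  rewrite coefZ coefXn eqxx mulr1 big_seq_cond big1 ?addr0 // => b /andP[bp ba].
  rewrite coefZ coefXn; case: eqP => [e|_]; last by rewrite mulr0.
  case/eqP: ba; apply/mnmP => i; apply: (digits_inj _ _ (esym e)) => j;
    exact: aB.
by rewrite -mcoeff_eq0 => /eqP.
Qed.

(** * Products of linear factors and Newton's identities *)

Section LinearFactors.
Variables (S : comNzRingType).

(** Division by X + c from the top: P_(j+1) = Q_j + c Q_(j+1) is iterated r times, until the
    remaining coefficient of Q lies beyond its size. *)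
Lemma coef_linear_factor (P Q : {poly S}) (c : S) (j r : nat) :
  P = ('X + c%:P) * Q -> (size Q <= j + r)%N ->
  Q`_j = \sum_(i < r) (- c) ^+ i * P`_(j.+1 + i).
Proof.
move=> PQ; have P1 i : P`_i.+1 = Q`_i + c * Q`_i.+1.
  by rewrite PQ mulrDl coefD coefXM coefCM.
suff H : Q`_j = \sum_(i < r) (- c) ^+ i * P`_(j.+1 + i)
                + (- c) ^+ r * Q`_(j + r).
  by move=> sQ; rewrite H [X in _ * X]nth_default // mulr0 addr0.
elim: r => [|r IH]; first by rewrite big_ord0 add0r expr0 mul1r addn0.
rewrite {1}IH big_ord_recr /= -addrA addSn P1 addnS; congr (_ + _).
by rewrite mulrDr -addrA exprSr mulrA mulrN mulNr addrN addr0.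
Qed.

Variables (k : nat) (t : 'I_k -> S).

Definition linear_prod : {poly S} := \prod_i ('X + (t i)%:P).
Local Notation P := linear_prod.

Lemma size_linear_prod : size P = k.+1.
Proof.
rewrite /P (eq_bigr (fun i => 'X - (- t i)%:P)) => [|i _].
  by rewrite size_prod_XsubC [index_enum _]unlock -enumT size_enum_ord.
by rewrite polyCN opprK.
Qed.

Lemma lead_linear_prod : P`_k = 1.
Proof.
have: P \is monic.
  rewrite /P (eq_bigr (fun i => 'X - (- t i)%:P)) ?monic_prod_XsubC // => i _.
  by rewrite polyCN opprK.
by rewrite monicE lead_coefE size_linear_prod => /eqP.
Qed.

Lemma coef_linear_prod_gt i : (k < i)%N -> P`_i = 0.
Proof. by move=> ki; rewrite nth_default // size_linear_prod. Qed.

Lemma coef_linear_prod j : (j <= k)%N ->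
  P`_(k - j) = \sum_(A : {set 'I_k} | #|A| == j) \prod_(i in A) t i.
Proof.
move=> jk; rewrite /P.
under eq_bigr do rewrite addrC.
rewrite bigA_distr coef_sum [RHS]big_mkcond /=.
apply: eq_bigr => A _; have Ak : (#|A| <= k)%N.
  by rewrite -[X in (_ <= X)%N]card_ord max_card.
have -> : \prod_i (if i \in A then (t i)%:P else 'X)
          = (\prod_(i in A) t i)%:P * 'X^(k - #|A|).
  rewrite rmorph_prod /= [X in X * _]big_mkcond /=.
  rewrite -[X in 'X^(X - _)]card_ord -cardsT -cardsDS ?subsetT // setTD.
  rewrite -prodr_const [X in _ * X]big_mkcond -big_split /=.
  by apply: eq_bigr => i _; rewrite inE; case: ifP; rewrite ?mulr1 ?mul1r.
rewrite coefCM coefXn eqn_sub2lE // eq_sym.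
by case: eqP; rewrite ?mulr1 ?mulr0.
Qed.

(** The signs make this a power sum of the roots - t_a of [linear_prod]. *)
Definition sign_power_sum (i : nat) : S := \sum_a (- t a) ^+ i.

Lemma root_linear_prod a : \sum_(i < k.+1) P`_i * (- t a) ^+ i = 0.
Proof.
rewrite -size_linear_prod -horner_coef /P (bigD1 a) //= hornerM.
by rewrite hornerD hornerX hornerC addNr mul0r.
Qed.

(* Newton's identities, from X P' = sum_a X P / (X + t_a). *)
Lemma newton_linear_prod j :
  P`_j *+ j = \sum_(i < k.+1) sign_power_sum i * P`_(j + i).
Proof.
have -> : \sum_(i < k.+1) sign_power_sum i * P`_(j + i)
   = \sum_a \sum_(i < k.+1) (- t a) ^+ i * P`_(j + i).
  by rewrite exchange_big; apply: eq_bigr => i _; rewrite mulr_suml.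
(* For j = 0 there is no coefficient of index j - 1 to compute; the sum vanishes because each - t_a
   is a root. *)
case: j => [|j].
  rewrite mulr0n big1 // => a _; rewrite -[RHS](root_linear_prod a).
  by apply: eq_bigr => i _; rewrite mulrC.
pose Q a := \prod_(b | b != a) ('X + (t b)%:P).
have PQ a : P = ('X + (t a)%:P) * Q a by rewrite /P (bigD1 a).
have <- : \sum_a (Q a)`_j = P`_j.+1 *+ j.+1.
  rewrite -coef_deriv (derivation_prod (derivation_deriv S)) coef_sum.
  apply: eq_bigr => a _; congr (nth 0 (polyseq _) _).
  rewrite [RHS](bigD1 a) //= eqxx.
  rewrite derivD derivX derivC addr0 mul1r.
  by apply: eq_bigr => b /negbTE ->.
apply: eq_bigr => a _; rewrite (coef_linear_factor (r := k.+1) (PQ a)) //.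
have : (size (Q a) <= size P)%N; last first.
  by rewrite size_linear_prod => /leq_trans; apply; rewrite leq_addl.
rewrite (PQ a) -[X in ('X + X)]opprK -polyCN.
rewrite size_monicM ?monicXsubC //.
  by rewrite size_XsubC.
apply/eqP => Q0; have := lead_linear_prod.
by rewrite (PQ a) Q0 mulr0 coef0 => /esym/eqP; rewrite oner_eq0.
Qed.

End LinearFactors.

(** * Conjugation and density *)

Section MapShifted.
Variables (S S' : idomainType) (f : {rmorphism S -> S'}) (n : nat).
Implicit Type Y : 'M[S]_n.

Lemma map_shifted_mx Y :
  map_mx (map_poly f) (shifted_mx Y) = shifted_mx (map_mx f Y).
Proof.
rewrite /shifted_mx map_mxD map_scalar_mx /= map_polyX -!map_mx_comp.
by congr (_ + _); apply/matrixP => i j; rewrite !mxE /= map_polyC.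
Qed.

Lemma map_adj_coef Y p : map_mx f (adj_coef Y p) = adj_coef (map_mx f Y) p.
Proof.
apply/matrixP => i j; rewrite mxE [adj_coef _ _ _ _]mxE [RHS]mxE.
by rewrite -map_shifted_mx -map_mx_adj [in RHS]mxE coef_map.
Qed.

Lemma map_minor_sum Y k : (k <= n)%N ->
  f (minor_sum Y k) = minor_sum (map_mx f Y) k.
Proof.
move=> kn; rewrite -!coef_det_shifted_mx // -map_shifted_mx det_map_mx.
by rewrite coef_map.
Qed.

End MapShifted.

Section Conjugation.
Variables (S : idomainType) (n : nat) (g Y Y' : 'M[S]_n).
Hypotheses (gu : g \in unitmx) (gY : Y' *m g = g *m Y).

Let gM : shifted_mx Y' *m map_mx polyC g = map_mx polyC g *m shifted_mx Y.
Proof.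
by rewrite /shifted_mx mulmxDl mulmxDr -!map_mxM gY scalar_mxC.
Qed.

Let detM : \det (shifted_mx Y') = \det (shifted_mx Y).
Proof.
have /(congr1 determinant) := gM; rewrite !det_mulmx mulrC; apply: mulfI.
rewrite det_map_mx polyC_eq0; apply: contraTneq gu => g0.
by rewrite unitmxE g0 unitr0.
Qed.

Lemma minor_sum_conj k : (k <= n)%N -> minor_sum Y' k = minor_sum Y k.
Proof. by move=> kn; rewrite -!coef_det_shifted_mx // detM. Qed.

(** With M' g = g M, multiplying either side of g adj M = adj M' g by M' gives det M times g; left
    multiplication by adj M' then allows cancelling the nonzero determinant. *)
Lemma adj_coef_conj p : g *m adj_coef Y p = adj_coef Y' p *m g.
Proof.
set G := map_mx polyC g.
suff e : G *m \adj (shifted_mx Y) = \adj (shifted_mx Y') *m G.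
  apply/matrixP => i j; have /matrixP/(_ i j) := e.
  rewrite [LHS]mxE [RHS]mxE => /(congr1 (coefp p)) /=; rewrite !coef_sum => E.
  rewrite [LHS]mxE [RHS]mxE.
  transitivity (\sum_j0 (G i j0 * \adj (shifted_mx Y) j0 j)`_p).
    by apply: eq_bigr => l _; rewrite [G _ _]mxE coefCM [adj_coef _ _ _ _]mxE.
  rewrite E; apply: eq_bigr => l _.
  by rewrite [adj_coef _ _ _ _]mxE [G _ _]mxE coefMC.
have E : shifted_mx Y' *m (G *m \adj (shifted_mx Y))
       = shifted_mx Y' *m (\adj (shifted_mx Y') *m G).
  rewrite !mulmxA gM mul_mx_adj -mulmxA mul_mx_adj detM.
  by rewrite scalar_mxC.
have := congr1 (mulmx (\adj (shifted_mx Y'))) E.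
rewrite ![_ *m (shifted_mx Y' *m _)]mulmxA mul_adj_mx !mul_scalar_mx => Z.
apply/matrixP => i j; have /matrixP/(_ i j) := Z; rewrite [LHS]mxE [RHS]mxE.
exact/mulfI/det_shifted_mx_neq0.
Qed.

End Conjugation.

Section DiagonalAdjugate.
Variables (S : idomainType) (n : nat) (t : 'I_n -> S).

Lemma shifted_diag_mx :
  shifted_mx (diag_mx (\row_i t i)) = diag_mx (\row_i ('X + (t i)%:P)).
Proof.
apply/matrixP => i j; rewrite !mxE.
by case: eqP => [->|_]; rewrite ?mulr1n ?mulr0n ?addr0.
Qed.

Lemma minor_sum_diag k : (k <= n)%N ->
  minor_sum (diag_mx (\row_i t i)) k = (linear_prod t)`_(n - k).
Proof.
move=> kn; rewrite -coef_det_shifted_mx // shifted_diag_mx det_diag.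
by congr (nth 0 (polyseq _) _); apply: eq_bigr => i _; rewrite mxE.
Qed.

(** The diagonal entry of the adjugate is the product of the other linear factors, that is, the
    quotient of [linear_prod] by X + t_a. *)
Lemma adj_coef_diag a p :
  adj_coef (diag_mx (\row_i t i)) p a a
  = \sum_(i < n.+1) (- t a) ^+ i * (linear_prod t)`_(p.+1 + i).
Proof.
rewrite mxE shifted_diag_mx; set D := diag_mx _.
pose Q := \prod_(b | b != a) ('X + (t b)%:P).
have PQ : linear_prod t = ('X + (t a)%:P) * Q by rewrite /linear_prod (bigD1 a).
have X0 b : 'X + (t b)%:P != 0 :> {poly S}.
  by rewrite -[t b]opprK polyCN polyXsubC_eq0.
have -> : \adj D a a = Q.
  apply: (mulfI (X0 a)); rewrite -PQ.
  have := mul_mx_adj D => /matrixP/(_ a a).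
  rewrite mul_diag_mx [LHS]mxE [X in X * _ = _]mxE => ->.
  rewrite mxE eqxx mulr1n det_diag.
  by apply: eq_bigr => i _; rewrite mxE.
apply: (coef_linear_factor PQ).
have : (size Q <= size (linear_prod t))%N; last first.
  by rewrite size_linear_prod => /leq_trans; apply; rewrite leq_addl.
rewrite PQ size_mul ?X0 //; last by apply/prodf_neq0 => b _; apply: X0.
by rewrite size_XaddC.
Qed.

End DiagonalAdjugate.

(** The minimal polynomial divides the characteristic polynomial, here a product of distinct linear
    factors. *)
Lemma trig_mx_diagonalizable (K : fieldType) (n : nat) (T : 'M[K]_n.+1) :
  is_trig_mx T -> injective (fun i => T i i) ->
  exists2 P, P \in unitmx & exists d, T = P *m diag_mx d *m invmx P.
Proof.
move=> Ttrig Tinj; have : diagonalizable T.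
  apply/diagonalizableP; exists [seq T i i | i <- enum 'I_n.+1].
    by rewrite map_inj_uniq ?enum_uniq.
  rewrite big_map big_enum /= -char_poly_trig //; exact: mxminpoly_dvd_char.
case=> P Pu /(similar_diagLR Pu)[d ->].
exists (invmx P); first by rewrite unitmx_inv.
by exists d; rewrite conjumx // unitmx_inv.
Qed.

(** Restricts p to the polynomial curve h, which reduces vanishing of p to one variable. *)
Lemma horner_mmap (K : comNzRingType) (k : nat) (p : {mpoly K[k]})
    (h : 'I_k -> {poly K}) (s : K) :
  (mmap polyC h p).[s] = p.@[fun i => (h i).[s]].
Proof.
elim/mpoly_alg_ind: p => [c|i|p q hp hq|p q hp hq].
- by rewrite mmapC hornerC mevalC.
- by rewrite mmapX mmap1U mevalXU.
- by rewrite rmorphD hornerD hp hq mevalD.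
- by rewrite rmorphM hornerM hp hq mevalM.
Qed.

(* Matrices with pairwise distinct eigenvalues are dense: a triangular matrix T
   is the value at s = 0 of T + s diag(0, ..., n-1), whose diagonal entries are
   pairwise distinct for all but finitely many s. *)
Lemma mpoly_eq0_diagonalizable (K : numClosedFieldType) (n : nat)
    (p : {mpoly K[n.+1 * n.+1]}) :
  (forall g d, g \in unitmx ->
     p.@[fun k => mxvec (g *m diag_mx d *m invmx g) 0 k] = 0) -> p = 0.
Proof.
move=> p0; apply: mpoly_eq0_meval => v; pose A := vec_mx (\row_k v k) : 'M_n.+1.
have [P /unitarymx_unit Pu] := Schur A (ltn0Sn n).
rewrite /similar_to /= conjumx // => Ttrig; set T := P *m A *m invmx P in Ttrig.
pose D := diag_mx (\row_i (i%:R : K)) : 'M_n.+1.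
(* A line through A at s = 0, whose points are conjugate to the triangular matrices T + s D. *)
pose L s := invmx P *m (T + s *: D) *m P.
have L0 : L 0 = A.
  rewrite /L scale0r addr0 /T !mulmxA mulVmx // mul1mx -mulmxA mulVmx //.
  by rewrite mulmx1.
pose h k : {poly K} := (mxvec A 0 k)%:P + (mxvec (invmx P *m D *m P) 0 k) *: 'X.
have hE s k : (h k).[s] = mxvec (L s) 0 k.
  rewrite hornerD hornerC hornerZ hornerX /L mulmxDr mulmxDl.
  rewrite -scalemxAr -scalemxAl linearD linearZ !mxE /=.
  have -> : invmx P *m T *m P = A by rewrite -L0 /L scale0r addr0.
  by rewrite mulrC.
pose q := mmap polyC h p.
(* The value of r at s is the product of the differences of the diagonal entries of T + s D; the
   coefficients i - j of s keep r nonzero. *)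
pose r : {poly K} := \prod_(ij : 'I_n.+1 * 'I_n.+1 | ij.1 != ij.2)
   ((T ij.1 ij.1 - T ij.2 ij.2)%:P + (ij.1%:R - ij.2%:R) *: 'X).
have r0 : r != 0.
  apply/prodf_neq0 => -[i j] /= ij; apply/eqP => /(congr1 (coefp 1)) /=.
  rewrite coefD coefC coefZ coefX coef0 /= add0r mulr1 => /eqP.
  by rewrite subr_eq0 eqr_nat (inj_eq val_inj) (negbTE ij).
(* Where r does not vanish, L s is diagonalizable and q is zero. Hence q r = 0, so q = 0, and its
   value at s = 0 is p at A. *)
have qr0 : q * r = 0.
  apply: poly_eq0_horner => s; rewrite hornerM.
  case: (eqVneq r.[s] 0) => [->|rs].
    by rewrite mulr0.
  rewrite /q horner_mmap (meval_eq _ (hE s)).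
  have TsE k l : (T + s *: D) k l = T k l + s * (k%:R *+ (k == l)).
    by rewrite [LHS]mxE; congr (_ + _); rewrite !mxE.
  have Ts_trig : is_trig_mx (T + s *: D).
    apply/is_trig_mxP => i j ij; rewrite TsE -val_eqE (ltn_eqF ij) mulr0 addr0.
    exact: (is_trig_mxP Ttrig).
  have [i j Tij|G Gu [d Ts]] := trig_mx_diagonalizable Ts_trig.
    apply/eqP; apply: contraTT rs => ij; rewrite negbK.
    rewrite /r horner_prod (bigD1 (i, j)) //= !hornerE.
    move: Tij; rewrite !TsE !eqxx !mulr1n => Tij.
    suff -> : T i i - T j j + (i%:R - j%:R) * s = 0 by rewrite mul0r.
    by rewrite mulrBl addrACA -opprD ![_ * s]mulrC Tij subrr.
  suff -> : L s = (invmx P *m G) *m diag_mx d *m invmx (invmx P *m G).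
    by rewrite p0 ?mul0r // unitmx_mul unitmx_inv Pu.
  rewrite /L Ts.
  have -> : invmx (invmx P *m G) = invmx G *m P.
    have e : (invmx P *m G) *m (invmx G *m P) = 1%:M.
      by rewrite mulmxA -[_ *m G *m _]mulmxA mulmxV // mulmx1 mulVmx.
    have [u _] := mulmx1_unit e.
    by rewrite -[LHS]mulmx1 -e mulKmx.
  by rewrite !mulmxA.
move/eqP: qr0; rewrite mulf_eq0 (negbTE r0) orbF => /eqP q0.
have := horner_mmap p h 0; rewrite -/q q0 horner0 => /esym.
rewrite (meval_eq _ (hE 0)) L0 => <-; apply: meval_eq => k.
by rewrite /A vec_mxK mxE.
Qed.

(** * Equivariance and restriction to diagonal matrices *)

Lemma map_mx_mulB (S S' : comNzRingType) (f : {rmorphism S -> S'}) (k : nat)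
    (A B Z : 'M[S]_k) (b : bool) :
  map_mx f A *m map_mx f B - b%:R *: map_mx f Z = map_mx f (A *m B - b%:R *: Z).
Proof. by rewrite map_mxB map_mxM map_mxZ /= rmorph_nat. Qed.

Section Evaluations.
Variables (R : realType) (n : nat).
Local Notation C := (complex R).

HB.instance Definition _ (Y : 'M[C]_n) :=
  GRing.RMorphism.copy (@eval_gl R n Y) (meval (fun k => mxvec Y 0 k)).

HB.instance Definition _ := GRing.RMorphism.copy (@restrict_h R n)
  (comp_mpoly [tuple mxvec (diag_mx (\row_(i < n) ('X_i : Sh R n))) 0 k
           | k < n * n]).

Lemma eval_gl_generic_mx (Y : 'M[C]_n) :
  map_mx (eval_gl Y) (generic_mx R n) = Y.
Proof.
apply/matrixP => i j; rewrite mxE [generic_mx _ _ _ _]mxE /eval_gl.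
by rewrite mevalXU mxvecE.
Qed.

Lemma restrict_h_generic_mx :
  map_mx (@restrict_h R n) (generic_mx R n) = diag_mx (\row_i 'X_i).
Proof.
apply/matrixP => i j; rewrite mxE [generic_mx _ _ _ _]mxE /restrict_h.
by rewrite comp_mpolyXU -tnth_nth tnth_mktuple mxvecE.
Qed.

Lemma meval_restrict_h (c : Sgl R n) (d : 'rV[C]_n) :
  (restrict_h c).@[fun i => d 0 i] = eval_gl (diag_mx d) c.
Proof.
rewrite /restrict_h comp_mpoly_meval; apply: meval_eq => k.
rewrite tnth_mktuple; case/mxvec_indexP: k => i j.
rewrite !mxvecE !mxE.
by case: eqP => [->|_]; rewrite ?mulr1n ?mulr0n ?mevalXU ?meval0.
Qed.

Lemma mderiv_generic_mx i j :
  map_mx (mderiv (mxvec_index i j)) (generic_mx R n) = delta_mx i j.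
Proof.
apply/matrixP => k l; rewrite mxE [generic_mx _ _ _ _]mxE mderiv_mvar mxE.
by rewrite (inj_eq (@cast_ord_inj _ _ _)) (inj_eq enum_rank_inj) xpair_eqE.
Qed.

(** The double sum in [gl_invariant] is a single derivation, sending the generic matrix Y to
    [A, Y]. *)
Lemma char_coef_gl_invariant k : (k <= n)%N -> gl_invariant (char_coef R n k).
Proof.
move=> kn A A'; rewrite pair_big.
apply: (@minor_sum_conj_invariant _ _ (generic_mx R n) (fun c =>
  \sum_(ij : 'I_n * 'I_n) mderiv (mxvec_index ij.1 ij.2) c
   * (A' *m generic_mx R n - generic_mx R n *m A') ij.1 ij.2) A') => //.
  by apply: derivation_lincomb => ij; exact: derivation_mderiv.
set B := _ - _; apply/matrixP => k1 l1.
have dY i j : mderiv (mxvec_index i j) (generic_mx R n k1 l1)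
     = ((k1 == i) && (l1 == j))%:R.
  by have /matrixP/(_ k1 l1) := mderiv_generic_mx i j; rewrite mxE [RHS]mxE.
rewrite mxE (bigD1 (k1, l1)) //= big1 => [|[i j] nij].
  by rewrite dY !eqxx mul1r addr0.
by rewrite dY -xpair_eqE eq_sym (negbTE nij) mul0r.
Qed.

End Evaluations.

(** * Generators of the big algebra *)

Section BigAlgebraGenerators.
Variables (R : realType) (n m : nat).
Local Notation C := (complex R).
Local Notation Sgl := (Sgl R n).
Local Notation N := #|{: weight n m}|.

Definition gl_op (i j : 'I_n) : 'M[Sgl]_N :=
  map_mx (@mpolyC (n * n) C) (@pi_gl R n m (delta_mx i j)).

Lemma mderiv_gl_op q k l : map_mx (mderiv q) (gl_op k l) = 0.
Proof.
apply/matrixP => a b.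
by rewrite [LHS]mxE [X in mderiv _ X]mxE [RHS]mxE mderivC.
Qed.

Lemma gl_op_normal_order i j k l :
  gl_op k l *m gl_op i j - (l == i)%:R *: gl_op k j
  = gl_op i l *m gl_op k j - (l == k)%:R *: gl_op i j.
Proof.
pose p i j := @pi_gl R n m (delta_mx i j).
have e1 := map_mx_mulB (@mpolyC (n * n) C) (p k l) (p i j) (p k j) (l == i).
have e2 := map_mx_mulB (@mpolyC (n * n) C) (p i l) (p k j) (p i j) (l == k).
have e3 := congr1 (map_mx (@mpolyC (n * n) C))
  (@pi_gl_normal_order R n m i j k l).
exact (etrans e1 (etrans e3 (esym e2))).
Qed.

Lemma KW_kirillov_wei (F : polmap R n m) :
  KW F = kirillov_wei (fun i j => mderiv (mxvec_index i j)) gl_op F.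
Proof. by []. Qed.

Lemma iter_KW_char_coef q k : (k <= n)%N ->
  exists z : int, exists r, iter q.+1 (@KW R n m) (char_coef R n k)%:M
     = z%:~R *: pi_mx gl_op (adj_coef (generic_mx R n) r).
Proof.
move=> kn; have two0 : (2%:R : Sgl) != 0.
  by rewrite -mpolyC_nat mpolyC_eq0 pnatr_eq0.
have [z [r e]] := iter_kirillov_wei_minor_sum
  (fun i j => derivation_mderiv C (mxvec_index i j))
  (@mderiv_generic_mx R n) two0
  (fun i j k l => mderiv_gl_op (mxvec_index i j) k l)
  gl_op_normal_order q kn.
exists z, r; exact: e.
Qed.

Lemma KW_char_coef k : (k <= n)%N ->
  KW ((char_coef R n k)%:M : polmap R n m)
  = pi_mx gl_op (adj_coef (generic_mx R n) (n - k)).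
Proof.
move=> kn; rewrite KW_kirillov_wei; apply: kirillov_wei_minor_sum kn.
  by move=> i j; exact: derivation_mderiv.
exact: mderiv_generic_mx.
Qed.

End BigAlgebraGenerators.

Lemma subst_mx_diag (K : comNzRingType) (n : nat) (d : 'rV[K]_n)
    (a : 'X_{1..n}) :
  subst_mx (diag_mx d) 'X_[a] = (\prod_i d 0 i ^+ a i) *: 'X_[a].
Proof.
rewrite /subst_mx comp_mpolyX mpolyXE_id -scaler_prod; apply: eq_bigr => i _.
rewrite tnth_mktuple -exprZn; congr (_ ^+ _).
rewrite (bigD1 i) //= mxE eqxx mulr1n big1 ?addr0 // => k /negbTE ki.
by rewrite mxE ki mulr0n scale0r.
Qed.

Lemma scalar_mx_diagE (S : pzSemiRingType) (k : nat) (c : S) (a : 'I_k) :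
  (c%:M : 'M_k) a a = c.
Proof. by rewrite mxE eqxx mulr1n. Qed.

Lemma rmorph_mulmx_diag (S S' : comNzRingType) (f : {rmorphism S -> S'})
    (k : nat) (A B : 'M[S]_k) (a : 'I_k) :
  (forall b, a != b -> f (A a b) = 0) ->
  f ((A *m B) a a) = f (A a a) * f (B a a).
Proof.
move=> A0; rewrite mxE raddf_sum (bigD1 a) //= big1 ?addr0 => [|b nb].
  exact: rmorphM.
by rewrite rmorphM A0 1?eq_sym // mul0r.
Qed.

Lemma mul_ffunE (T : finType) (S : pzSemiRingType) (f g : {ffun T -> S}) x :
  (f * g) x = f x * g x.
Proof. exact: ffunE. Qed.

(** * Equivariant maps and their scalars on weight spaces *)

Section Equivariance.
Variables (R : realType) (n m : nat).
Local Notation C := (complex R).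
Local Notation Sgl := (Sgl R n).
Local Notation N := #|{: weight n m}|.

Lemma eval_polmap_pi_mx (G : 'M[Sgl]_n) (Y : 'M[C]_n) :
  eval_polmap (pi_mx (@gl_op R n m) G) Y = pi_gl m (map_mx (eval_gl Y) G).
Proof.
rewrite pi_gl_sum; apply/matrixP => a b.
rewrite mxE !summxE (raddf_sum (eval_gl Y)) /=; apply: eq_bigr => i _.
rewrite !summxE (raddf_sum (eval_gl Y)) /=; apply: eq_bigr => j _.
rewrite [X in eval_gl Y X]mxE [RHS]mxE (rmorphM (eval_gl Y)) /=.
congr (_ * _); first by rewrite mxE.
by rewrite mxE; exact: mevalC.
Qed.

Let Sgl_id : idomainType := Sgl.
Let C_id : idomainType := C.

Lemma eval_gl_char_coef (Y : 'M[C]_n) k : (k <= n)%N ->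
  eval_gl Y (char_coef R n k) = @minor_sum C_id n Y k.
Proof.
move=> kn.
have := @map_minor_sum Sgl_id C_id (eval_gl Y) n (generic_mx R n) k kn.
by rewrite eval_gl_generic_mx.
Qed.

Lemma eval_gl_adj_coef (Y : 'M[C]_n) p :
  map_mx (eval_gl Y) (adj_coef (generic_mx R n) p) = @adj_coef C_id n Y p.
Proof.
have := @map_adj_coef Sgl_id C_id (eval_gl Y) n (generic_mx R n) p.
by rewrite eval_gl_generic_mx.
Qed.

Lemma equivariant_char_coef k : (k <= n)%N ->
  ((char_coef R n k)%:M : polmap R n m) \in @equivariant R n m.
Proof.
move=> kn; apply/asboolP => g Y gu; rewrite !eval_polmap_scalar scalar_mxC.
rewrite !eval_gl_char_coef // (minor_sum_conj gu (Y := Y)) //.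
by rewrite mulmxKV.
Qed.

Lemma equivariant_pi_adj_coef p :
  (pi_mx (@gl_op R n m) (adj_coef (generic_mx R n) p) : polmap R n m)
    \in @equivariant R n m.
Proof.
apply/asboolP => g Y gu; rewrite !eval_polmap_pi_mx !eval_gl_adj_coef.
apply/esym/rho_pi_gl/(adj_coef_conj gu).
by rewrite mulmxKV.
Qed.

Lemma rho_diag (d : 'rV[C]_n) :
  rho m (diag_mx d) = diag_mx (\row_a \prod_i d 0 i ^+ @basis_mnm n m a i).
Proof.
apply/matrixP => a b.
rewrite mxE -/(subst_mx _ _) subst_mx_diag mcoeffZ mcoeffX.
rewrite (inj_eq (@basis_mnm_inj n m)) !mxE eq_sym.
by case: eqP => [->|_]; rewrite ?mulr1 ?mulr0.
Qed.

(** Diagonal matrices commute with the torus, so by equivariance F(diag d) does too, and distinct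
    monomials have distinct torus characters. *)
Lemma restrict_h_offdiag (F : polmap R n m) a b :
  F \in @equivariant R n m -> a != b -> restrict_h (F a b) = 0.
Proof.
move=> /asboolP Feq ab; apply: mpoly_eq0_meval => v.
pose d := \row_i v i.
transitivity ((restrict_h (F a b)).@[fun i => d 0 i]).
  by apply: meval_eq => i; rewrite mxE.
rewrite meval_restrict_h.
have [i abi] : exists i, basis_mnm a i != basis_mnm b i.
  apply/existsP; apply: contraNT ab => /existsPn nab.
  apply/eqP/basis_mnm_inj/mnmP => i; apply/eqP.
  by have := nab i; rewrite negbK.
(* This torus element multiplies a monomial by 2 to the power of its i-th exponent, which separates
   a from b. *)
pose e : 'rV[C]_n := \row_k (if k == i then 2%:R else 1).
have eE (c : 'I_N) : \prod_k e 0 k ^+ basis_mnm c k = 2%:R ^+ basis_mnm c i.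
  rewrite (bigD1 i) //= mxE eqxx big1 ?mulr1 // => k /negbTE ki.
  by rewrite mxE ki expr1n.
have eu : diag_mx e \in unitmx.
  rewrite unitmxE det_diag unitfE; apply/prodf_neq0 => k _; rewrite mxE.
  by case: ifP => _; rewrite ?oner_eq0 // pnatr_eq0.
have := Feq _ (diag_mx d) eu; rewrite diag_mxC mulmxK // rho_diag.
move=> /matrixP/(_ a b); rewrite mul_mx_diag mul_diag_mx.
rewrite [LHS]mxE [RHS]mxE [X in X * _]mxE [X in _ * X]mxE.
rewrite [X in _ = _ * X]mxE [X in _ = X * _]mxE.
rewrite !eE => /eqP; rewrite mulrC -subr_eq0 -mulrBl mulf_eq0.
case/orP => [|/eqP//]; rewrite subr_eq0 -!natrX eqr_nat eqn_exp2l //.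
by rewrite eq_sym (negbTE abi).
Qed.

(** Defined on all polynomial maps; it becomes multiplicative once the left factor is equivariant,
    hence diagonal on diagonal matrices. *)
Definition weight_fun (F : polmap R n m) : Func R n m :=
  [ffun mu => restrict_h (F (enum_rank mu) (enum_rank mu))].

Lemma weight_funE F mu :
  weight_fun F mu = restrict_h (F (enum_rank mu) (enum_rank mu)).
Proof. exact: ffunE. Qed.

Lemma Func_constE f mu : Func_const m f mu = f :> Sh R n.
Proof. exact: ffunE. Qed.

Lemma weight_funB F G : weight_fun (F - G) = weight_fun F - weight_fun G.
Proof.
apply/ffunP => mu; rewrite !ffunE [(F - G) _ _]mxE [(- G) _ _]mxE.
exact: rmorphB.
Qed.

Lemma weight_fun_scalar c : weight_fun c%:M = Func_const m (restrict_h c).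
Proof.
apply/ffunP => mu; apply: (etrans (weight_funE _ _)).
apply: (etrans _ (esym (Func_constE _ _))).
exact: (congr1 (@restrict_h R n) (scalar_mx_diagE c (enum_rank mu))).
Qed.

Lemma weight_funM F G : F \in @equivariant R n m ->
  weight_fun (F *m G) = weight_fun F * weight_fun G.
Proof.
move=> Feq; apply/ffunP => mu; apply: (etrans (weight_funE _ _)).
apply: (etrans _ (esym (mul_ffunE _ _ _))).
apply: (etrans _ (esym (congr2 *%R (weight_funE F mu) (weight_funE G mu)))).
apply: (@rmorph_mulmx_diag Sgl (Sh R n) (@restrict_h R n)) => b.
exact: restrict_h_offdiag.
Qed.

Lemma weight_fun_eq0 (F : polmap R n m) : (0 < n)%N ->
  F \in @equivariant R n m -> weight_fun F = 0 -> F = 0.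
Proof.
move=> n0 Feq F0.
have Fd (d : 'rV[C]_n) : eval_polmap F (diag_mx d) = 0.
  apply/matrixP => a b; rewrite [LHS]mxE [RHS]mxE -meval_restrict_h.
  case: (eqVneq a b) => [<-|ab]; last by rewrite restrict_h_offdiag // meval0.
  have /ffunP/(_ (enum_val a)) := F0.
  rewrite weight_funE [RHS]ffunE enum_valK => ->.
  exact: meval0.
apply/matrixP => a b; rewrite [RHS]mxE.
move: F Feq {F0} Fd; case: n n0 a b => [//|n'] _ a b F /asboolP Feq Fd.
apply: mpoly_eq0_diagonalizable => g d gu.
have := Feq g (diag_mx d) gu; rewrite Fd mulmx0 => e.
have {}e : eval_polmap F (g *m diag_mx d *m invmx g) = 0.
  have := congr1 (mulmx^~ (invmx (rho m g))) e.
  by rewrite mulmxK ?rho_unitmx // mul0mx.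
by have /matrixP/(_ a b) := e; rewrite [LHS]mxE [RHS]mxE.
Qed.

(** The operator x_a d/dx_a multiplies the monomial of exponent mu by mu_a, whereas x_i d/dx_j with
    i different from j has no diagonal entry. *)
Lemma weight_fun_pi_mx (G : 'M[Sgl]_n) :
  weight_fun (pi_mx (@gl_op R n m) G)
  = [ffun mu => \sum_a restrict_h (G a a) *+ weight_mnm mu a].
Proof.
apply/ffunP => mu; rewrite weight_funE [RHS]ffunE.
have pE i j : @pi_gl R n m (delta_mx i j) (enum_rank mu) (enum_rank mu)
    = (i == j)%:R *+ weight_mnm mu i.
  rewrite mxE -/(dl _ _) dl_delta mderivX -scalerAr -mpolyXD mcoeffZ mcoeffX.
  rewrite /basis_mnm enum_rankK; case: (posnP (weight_mnm mu j)) => [mj|mj].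
    rewrite mj mul0r; case: eqP => [->|_]; last by rewrite mul0rn.
    by rewrite mj mulr0n.
  have le1 : (U_(j) <= weight_mnm mu)%MM by rewrite lep1mP -lt0n.
  rewrite -[X in _ == X](submK le1) addmC eqm_add2l.
  have -> : (U_(i)%MM == U_(j)%MM) = (i == j).
    apply/eqP/eqP => [/mnmP/(_ j)|-> //]; rewrite !mnm1E eqxx.
    by case: eqP.
  by case: eqP => [->|_]; rewrite ?mulr1 // mulr0 mul0rn.
pose a := enum_rank mu; rewrite -/a.
have {}pE i j :
  restrict_h (gl_op R m i j a a) = ((i == j)%:R *+ weight_mnm mu i)%:MP.
  by rewrite mxE pE; exact: comp_mpolyC.
rewrite summxE (raddf_sum (@restrict_h R n)) /=; apply: eq_bigr => i _.
rewrite summxE (raddf_sum (@restrict_h R n)) /= (bigD1 i) //= big1 => [|j ji].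
  rewrite addr0 mxE (rmorphM (@restrict_h R n)) /= pE eqxx.
  by rewrite mpolyCMn mulrnAr mulr1.
rewrite mxE (rmorphM (@restrict_h R n)) /= pE eq_sym (negbTE ji) mul0rn.
by rewrite mpolyC0 mulr0.
Qed.

End Equivariance.

(** * Functions on the weights *)

Lemma msym_sign_power_sum (K : comNzRingType) (k r : nat) :
  \sum_(j < k) (- 'X_j) ^+ r \is @symmetric k K.
Proof.
apply/issymP => s; rewrite raddf_sum /=.
rewrite [RHS](reindex_inj (@perm_inj _ s)) /=; apply: eq_bigr => j _.
by rewrite rmorphXn rmorphN /= /msym mmapX mmap1U.
Qed.

Section RepeatedVars.
Variables (R : realType) (n m : nat).
Local Notation C := (complex R).

Lemma size_repeated_vars (mu : weight n m) :
  size (flatten [seq nseq (weight_mnm mu i) ('X_i : Sh R n) | i <- enum 'I_n])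
  = m.
Proof.
rewrite size_flatten /shape -map_comp sumnE big_map big_enum /=.
rewrite -[RHS](mdeg_weight_mnm mu) mdegE; apply: eq_bigr => i _.
by rewrite size_nseq.
Qed.

Lemma sum_repeated_vars (mu : weight n m) (phi : Sh R n -> Sh R n) :
  \sum_(j < m) phi (tnth (repeated_vars R mu) j)
  = \sum_i phi 'X_i *+ weight_mnm mu i.
Proof.
set s := flatten [seq nseq (weight_mnm mu i) ('X_i : Sh R n) | i <- enum 'I_n].
transitivity (\sum_(x <- s) phi x).
  rewrite (big_nth 0) big_mkord size_repeated_vars; apply: eq_bigr => j _.
  by rewrite tnth_mktuple.
rewrite /s big_flatten big_map big_enum; apply: eq_bigr => i _ /=.
by rewrite big_nseq iter_addr_0.
Qed.

End RepeatedVars.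

Lemma comp_mpoly_comp (K : comNzRingType) (k l r : nat) (u : {mpoly K[k]})
    (a : k.-tuple {mpoly K[l]}) (b : l.-tuple {mpoly K[r]}) :
  (u \mPo a) \mPo b = u \mPo [tuple tnth a i \mPo b | i < k].
Proof.
elim/mpoly_alg_ind: u => [c|i|p q hp hq|p q hp hq].
- by rewrite !comp_mpolyC.
- by rewrite !comp_mpolyXU -!tnth_nth tnth_mktuple.
- by rewrite !comp_mpolyD hp hq.
- by rewrite !rmorphM /= hp hq.
Qed.

Section PointwiseComposition.
Variables (K : comNzRingType) (T : finType) (k l : nat).
Variable a : T -> k.-tuple {mpoly K[l]}.

Lemma ffun_comp_mpolyD p q :
  [ffun x => (p + q) \mPo a x]
  = [ffun x => p \mPo a x] + [ffun x => q \mPo a x].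
Proof. by apply/ffunP => x; rewrite !ffunE comp_mpolyD. Qed.

Lemma ffun_comp_mpolyM p q :
  [ffun x => (p * q) \mPo a x]
  = [ffun x => p \mPo a x] * [ffun x => q \mPo a x].
Proof. by apply/ffunP => x; rewrite mul_ffunE !ffunE rmorphM. Qed.

End PointwiseComposition.

Section Functions.
Variables (R : realType) (n m : nat).
Local Notation C := (complex R).
Local Notation Func := (Func R n m).

Local Notation P := (linear_prod (fun i : 'I_n => 'X_i : Sh R n)).

(** The power sums of the negatives of the repeated variables, which places them in [F1]. *)
Definition psum (r : nat) : Func :=
  [ffun mu => \sum_a (- 'X_a) ^+ r *+ weight_mnm mu a].

(** Indexed by the power of X: for k at most n, the restriction of c_k is the value of
    [ecoef (n - k)]. *)
Definition ecoef (j : nat) : Func := Func_const m P`_j.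

Lemma psumE r mu : psum r mu = \sum_a (- 'X_a) ^+ r *+ weight_mnm mu a.
Proof. exact: ffunE. Qed.

Lemma restrict_h_char_coef k : (k <= n)%N ->
  restrict_h (char_coef R n k) = P`_(n - k).
Proof.
move=> kn.
have := @map_minor_sum (Sgl R n : idomainType) (Sh R n : idomainType)
  (@restrict_h R n) n (generic_mx R n) k kn.
rewrite restrict_h_generic_mx => e; apply: (etrans e).
exact: (@minor_sum_diag (Sh R n : idomainType)).
Qed.

Lemma linear_prod_mvar_symmetric j : P`_j \is symmetric.
Proof.
case: (leqP j n) => [jn|nj]; last by rewrite coef_linear_prod_gt ?rpred0.
by rewrite -(subKn jn) coef_linear_prod ?leq_subr //; apply: mesym_sym.
Qed.

Lemma weight_fun_pi_adj_coef r :
  weight_fun (pi_mx (@gl_op R n m) (adj_coef (generic_mx R n) r))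
  = \sum_(i < n.+1) psum i * ecoef (r.+1 + i).
Proof.
rewrite weight_fun_pi_mx; apply/ffunP => mu; rewrite ffunE sum_ffunE.
have aE a : restrict_h (adj_coef (generic_mx R n) r a a)
   = \sum_(i < n.+1) (- 'X_a) ^+ i * P`_(r.+1 + i).
  have := @map_adj_coef (Sgl R n : idomainType) (Sh R n : idomainType)
     (@restrict_h R n) n (generic_mx R n) r.
  rewrite restrict_h_generic_mx => /matrixP/(_ a a) e.
  rewrite mxE in e; apply: (etrans e).
  exact: (@adj_coef_diag (Sh R n : idomainType)).
under eq_bigr => a _ do rewrite aE -sumrMnl.
rewrite exchange_big; apply: eq_bigr => i _ /=.
rewrite mul_ffunE psumE Func_constE mulr_suml.
by apply: eq_bigr => a _; rewrite mulrnAl.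
Qed.

(** * Sets of functions closed under the algebra operations *)

Section Closure.
Local Notation iota := (@Func_iota R n m).
(** Q is later the image of the big algebra, and also the algebra generated by [F0] and [F1]. *)
Variable Q : Func -> Prop.
Hypotheses (QC : forall a, Q (iota a))
  (QD : forall f g, Q f -> Q g -> Q (f + g))
  (QM : forall f g, Q f -> Q g -> Q (f * g)).

Lemma iotaE a mu : iota a mu = a%:MP.
Proof. exact: ffunE. Qed.

Lemma closed0 : Q 0.
Proof.
suff -> : (0 : Func) = iota 0 by [].
by apply/ffunP => mu; rewrite [RHS]iotaE mpolyC0 ffunE.
Qed.

Lemma closedN f : Q f -> Q (- f).
Proof.
move=> Qf; suff -> : - f = iota (-1) * f by apply: QM.
apply/ffunP => mu; rewrite mul_ffunE iotaE.
by rewrite [LHS]ffunE mpolyCN mpolyC1 mulN1r.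
Qed.

Lemma closed_sum (I : finType) (p : pred I) (f : I -> Func) :
  (forall i, p i -> Q (f i)) -> Q (\sum_(i | p i) f i).
Proof. by move=> Qf; apply: (big_ind Q) => //; exact: closed0. Qed.

Lemma closed_div f k : (0 < k)%N -> Q (f *+ k) -> Q f.
Proof.
move=> k0 Qf; suff -> : f = iota (k%:R^-1) * (f *+ k) by apply: QM.
apply/ffunP => mu; rewrite mul_ffunE iotaE ffunMnE mul_mpolyC.
by rewrite -[f mu *+ k]scaler_nat scalerA mulVf ?scale1r // pnatr_eq0 -lt0n.
Qed.

Lemma closed_comp (k : nat) (u : {mpoly C[k]}) (h : 'I_k -> Func) :
  (forall i, Q (h i)) -> Q [ffun mu => u \mPo [tuple h i mu | i < k]].
Proof.
move=> Qh; elim/mpoly_alg_ind: u => [c|i|p q hp hq|p q hp hq].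
- suff -> : [ffun mu => c%:MP \mPo [tuple h i mu | i < k]] = iota c by [].
  by apply/ffunP => mu; rewrite iotaE ffunE comp_mpolyC.
- suff -> : [ffun mu => 'X_i \mPo [tuple h j mu | j < k]] = h i by [].
  by apply/ffunP => mu; rewrite ffunE comp_mpolyXU -tnth_nth tnth_mktuple.
- exact: (eq_ind_r Q (QD hp hq) (ffun_comp_mpolyD _ p q)).
- exact: (eq_ind_r Q (QM hp hq) (ffun_comp_mpolyM _ p q)).
Qed.

Lemma ecoef_lead : ecoef n = 1.
Proof.
by apply/ffunP => mu; rewrite Func_constE lead_linear_prod ffunE.
Qed.

Lemma ecoef_gt j : (n < j)%N -> ecoef j = 0.
Proof.
by move=> nj; apply/ffunP => mu; rewrite Func_constE coef_linear_prod_gt ?ffunE.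
Qed.

(** Each - t_a is a root of P, so the sequence of power sums satisfies the linear recurrence with
    characteristic polynomial P. *)
Lemma psum_linear_recurrence d : \sum_(i < n.+1) psum (d + i) * ecoef i = 0.
Proof.
apply/ffunP => mu; rewrite sum_ffunE [RHS]ffunE.
transitivity (\sum_a (\sum_(i < n.+1) P`_i * (- 'X_a) ^+ i) * (- 'X_a) ^+ d
                       *+ weight_mnm mu a).
  under [RHS]eq_bigr => a _ do rewrite mulr_suml -sumrMnl.
  rewrite exchange_big; apply: eq_bigr => i _ /=.
  rewrite mul_ffunE psumE Func_constE mulr_suml; apply: eq_bigr => a _.
  by rewrite mulrnAl mulrC -mulrA -exprD addnC.
by apply: big1 => a _; rewrite root_linear_prod mul0r mul0rn.
Qed.

(** Strong induction on r. For r < n the assumed sum with k = n - r is triangular: its last nonzero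
    term is [psum r], since [ecoef n] is 1. For larger r the recurrence reduces to smaller
    indices. *)
Lemma closed_psum :
  (forall j, Q (ecoef j)) ->
  (forall k, (0 < k <= n)%N -> Q (\sum_(i < n.+1) psum i * ecoef (k + i))) ->
  forall r, Q (psum r).
Proof.
move=> Qe Qg; elim/ltn_ind => r IH; case: (ltnP r n) => rn.
  have := Qg (n - r)%N; rewrite subn_gt0 rn leq_subr => /(_ isT).
  have rn1 : (r < n.+1)%N by rewrite ltnS ltnW.
  rewrite (bigD1 (Ordinal rn1)) //= subnK 1?ltnW // ecoef_lead mulr1.
  set T := \sum_(i < n.+1 | _) _ => Qs.
  have QT : Q T.
    apply: closed_sum => i ir; case: (ltngtP i r) => [lt|gt|e].
    - by apply: QM; [exact: IH | exact: Qe].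
    - rewrite ecoef_gt ?mulr0; first exact: closed0.
      by rewrite -{1}(subnK (ltnW rn)) ltn_add2l.
    - by case/eqP: ir; apply: val_inj.
  by rewrite -[psum r](addrK T); apply: QD => //; apply: closedN.
have := psum_linear_recurrence (r - n).
rewrite big_ord_recr /= subnK // ecoef_lead mulr1 addrC => /eqP.
rewrite addr_eq0 => /eqP ->; apply: closedN; apply: closed_sum => i _.
apply: QM => //; apply: IH.
by rewrite -{2}(subnK rn) ltn_add2l.
Qed.

(** For j at most m, [rep_coef (m - j)] is the j-th elementary symmetric polynomial in the repeated
    variables. *)
Definition rep_coef (j : nat) : Func :=
  [ffun mu => (linear_prod (tnth (repeated_vars R mu)))`_j].

Lemma rep_coefE j mu :
  rep_coef j mu = (linear_prod (tnth (repeated_vars R mu)))`_j.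
Proof. exact: ffunE. Qed.

(** Newton's identities with the power sum of exponent 0 split off; it equals m because the weight
    has degree m. *)
Lemma newton_rep_coef j :
  rep_coef j *+ j
  = rep_coef j *+ m + \sum_(i < m) psum i.+1 * rep_coef (j + i.+1).
Proof.
apply/ffunP => mu; rewrite ffunMnE rep_coefE newton_linear_prod.
have sE r : sign_power_sum (tnth (repeated_vars R mu)) r = psum r mu.
  by rewrite psumE -(sum_repeated_vars mu (fun x => (- x) ^+ r)).
rewrite big_ord_recl /= ffunE ffunMnE sum_ffunE sE addn0; congr (_ + _).
  rewrite psumE rep_coefE -[RHS]mulr_natl; congr (_ * _).
  rewrite -[in RHS](mdeg_weight_mnm mu) mdegE natr_sum.
  by apply: eq_bigr => a _; rewrite expr0.
by apply: eq_bigr => i _; rewrite mul_ffunE rep_coefE sE.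
Qed.

(** Descending induction on j from the leading coefficient 1: Newton's identities express (m - j)
    times the j-th coefficient through higher ones, and m - j is invertible in C. The parameter d
    bounds m - j. *)
Lemma closed_rep_coef : (forall r, Q (psum r)) -> forall j, Q (rep_coef j).
Proof.
move=> Qp; have Qd : forall d j, (m <= j + d)%N -> Q (rep_coef j).
  elim=> [|d IH] j.
    rewrite addn0 leq_eqVlt => /orP[/eqP mj|mj].
      suff -> : rep_coef j = iota 1 by [].
      apply/ffunP => mu; rewrite rep_coefE iotaE mpolyC1 -mj.
      exact: lead_linear_prod.
    suff -> : rep_coef j = 0 by exact: closed0.
    by apply/ffunP => mu; rewrite rep_coefE coef_linear_prod_gt ?ffunE.
  case: (leqP m (j + d)) => [/IH //|jd mj].
  have jm : (j < m)%N by apply: leq_ltn_trans jd; apply: leq_addr.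
  apply: (@closed_div _ (m - j)); first by rewrite subn_gt0.
  have -> : rep_coef j *+ (m - j)
            = - \sum_(i < m) psum i.+1 * rep_coef (j + i.+1).
    rewrite mulrnBr 1?ltnW // newton_rep_coef opprD addrA subrr.
    by rewrite add0r.
  apply: closedN; apply: closed_sum => i _; apply: QM => //; apply: IH.
  by rewrite (leq_trans mj) // -addnA leq_add2l addSn ltnS leq_addl.
by move=> j; apply: (Qd m); rewrite leq_addl.
Qed.

(** By the fundamental theorem of symmetric polynomials it suffices to reach the elementary ones,
    which are values of [ecoef]; [closed_F1] argues alike with [rep_coef]. *)
Lemma closed_F0 h : (forall j, Q (ecoef j)) -> F0 h -> Q h.
Proof.
move=> Qe [f fsym ->]; have [u [<- _]] := sym_fundamental fsym.
suff -> : Func_const m (u \mPo [tuple mesym n C i.+1 | i < n])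
   = [ffun mu => u \mPo [tuple ecoef (n - i.+1) mu | i < n]].
  exact: (closed_comp _ (fun i => Qe (n - i.+1)%N)).
have e mu : [tuple mesym n C i.+1 | i < n]
            = [tuple ecoef (n - i.+1) mu | i < n].
  apply: eq_mktuple => i; apply: (etrans _ (esym (Func_constE _ _))).
  apply: esym; apply: coef_linear_prod; exact: ltn_ord.
apply: eq_ffun => mu.
exact: (congr1 (fun t => u \mPo t) (e mu)).
Qed.

Lemma closed_F1 h : (forall r, Q (psum r)) -> F1 h -> Q h.
Proof.
move=> Qp [f fsym ->]; have [u [<- _]] := sym_fundamental fsym.
suff -> : [ffun mu =>
    (u \mPo [tuple mesym m C i.+1 | i < m]) \mPo repeated_vars R mu]
   = [ffun mu => u \mPo [tuple rep_coef (m - i.+1) mu | i < m]].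
  exact: (closed_comp _ (fun i => closed_rep_coef Qp (m - i.+1)%N)).
have e mu : [tuple tnth [tuple mesym m C i.+1 | i < m] i \mPo repeated_vars R mu
             | i < m] = [tuple rep_coef (m - i.+1) mu | i < m].
  apply: eq_mktuple => i; apply: (etrans _ (esym (rep_coefE _ _))).
  rewrite tnth_mktuple coef_linear_prod; last exact: ltn_ord.
  rewrite /mesym raddf_sum; apply: eq_bigr => A _ /=.
  rewrite rmorph_prod; apply: eq_bigr => j _ /=.
  by rewrite comp_mpolyXU -tnth_nth.
apply: eq_ffun => mu; apply: (etrans (comp_mpoly_comp _ _ _)).
exact: (congr1 (fun t => u \mPo t) (e mu)).
Qed.

End Closure.

Definition func_algebra : Func -> Prop :=
  gen_subalgebra (@Func_iota R n m) (fun x => F0 x \/ F1 x).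

Lemma func_algebra_ecoef j : func_algebra (ecoef j).
Proof.
apply: gen_in; left; exists P`_j => //.
exact: linear_prod_mvar_symmetric.
Qed.

Lemma func_algebra_psum r : func_algebra (psum r).
Proof.
apply: gen_in; right; exists (\sum_(j < m) (- 'X_j) ^+ r).
  exact: msym_sign_power_sum.
apply/ffunP => mu; rewrite psumE [RHS]ffunE.
rewrite -(sum_repeated_vars mu (fun x => (- x) ^+ r)) raddf_sum.
apply: eq_bigr => j _ /=; rewrite rmorphXn rmorphN /= comp_mpolyXU -tnth_nth.
by [].
Qed.

End Functions.

(** * The weight homomorphism *)

Lemma dl_diag (K : comNzRingType) (n : nat) (d : 'rV[K]_n) (a : 'X_{1..n}) :
  dl (diag_mx d) 'X_[a] = (\sum_i d 0 i *+ a i) *: 'X_[a].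
Proof.
rewrite /dl scaler_suml; apply: eq_bigr => i _.
rewrite (bigD1 i) //= big1 ?addr0 => [|j ji]; last first.
  by rewrite mxE eq_sym (negbTE ji) scale0r.
rewrite mxE eqxx mulr1n mderivX -scalerAr scalerA -[d 0 i *+ a i]mulr_natr.
case: (posnP (a i)) => [->|ai]; first by rewrite mulr0 !scale0r.
congr (_ *: _); rewrite -mpolyXD addmC submK //.
by rewrite lep1mP -lt0n.
Qed.

Lemma rmorph_scale_int_mxE (S S' : comNzRingType) (f : {rmorphism S -> S'})
    (k : nat) (z : int) (A : 'M[S]_k) a b :
  f ((z%:~R *: A) a b) = z%:~R * f (A a b).
Proof. by rewrite mxE rmorphM /= rmorph_int. Qed.

Section WeightHomomorphism.
Variables (R : realType) (n m : nat).
Local Notation C := (complex R).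
Local Notation Sgl := (Sgl R n).
Local Notation Func := (Func R n m).
Local Notation big := (big_algebra R n m).

Definition weight_hom (F : big) : Func := weight_fun F.

Lemma big_equivariant (F : big) : (F : polmap R n m) \in @equivariant R n m.
Proof. exact: (valP (val F)). Qed.

Fact weight_hom_is_zmod_morphism : zmod_morphism weight_hom.
Proof. move=> F G; exact: (weight_funB F G). Qed.

Lemma weight_fun_const (a : C) :
  weight_fun ((a%:MP : Sgl)%:M : polmap R n m) = Func_iota n m a.
Proof.
have e := @weight_fun_scalar R n m a%:MP.
have e2 : restrict_h (a%:MP : Sgl) = a%:MP := comp_mpolyC _ _.
rewrite e2 in e.
exact: e.

Qed.

Lemma weight_fun_scale_int (z : int) (G : polmap R n m) :
  weight_fun (z%:~R *: G) = Func_iota n m z%:~R * weight_fun G.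
Proof.
apply/ffunP => mu; have e1 := weight_funE (z%:~R *: G) mu.
have e2 := mul_ffunE (Func_iota n m (z%:~R : C)) (weight_fun G) mu.
have e3 := @iotaE R n m (z%:~R) mu.
have e4 := weight_funE G mu.
rewrite rmorph_int in e3; rewrite e3 e4 in e2.
rewrite (@rmorph_scale_int_mxE Sgl (Sh R n) (@restrict_h R n)) in e1.
by rewrite e1 e2.
Qed.

Lemma weight_fun1 : weight_fun (1 : polmap R n m) = 1.
Proof.
apply/ffunP => mu; apply: (etrans (weight_funE _ _)).
apply: (etrans (congr1 (@restrict_h R n) (scalar_mx_diagE 1 _))).
by rewrite rmorph1 ffunE.
Qed.

Lemma weight_fun0 : weight_fun (0 : polmap R n m) = 0.
Proof. by have := weight_funB (0 : polmap R n m) 0; rewrite !subrr. Qed.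

Fact weight_hom_is_monoid_morphism : monoid_morphism weight_hom.
Proof.
split; first exact: weight_fun1.
move=> F G; exact: (weight_funM G (big_equivariant F)).
Qed.

HB.instance Definition _ := GRing.isZmodMorphism.Build big Func weight_hom
  weight_hom_is_zmod_morphism.
HB.instance Definition _ := GRing.isMonoidMorphism.Build big Func weight_hom
  weight_hom_is_monoid_morphism.

Lemma weight_hom_inj : (0 < n)%N -> injective weight_hom.
Proof.
move=> n0 F G FG; apply/eqP; rewrite -subr_eq0; apply/eqP.
apply/val_inj/val_inj; apply: (weight_fun_eq0 n0); first exact: big_equivariant.
apply: (etrans (weight_hom_is_zmod_morphism F G)).
by rewrite FG subrr.
Qed.

Lemma big_algebra_exists (F : polmap R n m) p q :
  F \in @equivariant R n m -> (p + q <= n)%N ->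
  F = iter q (@KW R n m) (char_coef R n (p + q))%:M ->
  exists G : big, (G : polmap R n m) = F.
Proof.
move=> Feq pq FE.
have Fin : Kirillov Feq \in @in_big R n m.
  by apply/asboolP/gen_in; exists p, q.
by exists (BigAlgebra Fin).
Qed.

Lemma big_char_coef k : (k <= n)%N ->
  exists G : big, (G : polmap R n m) = (char_coef R n k)%:M.
Proof.
move=> kn; apply: (@big_algebra_exists _ k 0); rewrite ?addn0 //.
exact: equivariant_char_coef.
Qed.

Lemma big_pi_adj_coef r : (r < n)%N ->
  exists G : big, (G : polmap R n m)
    = pi_mx (@gl_op R n m) (adj_coef (generic_mx R n) r).
Proof.
move=> rn; have e : ((n - r).-1 + 1 = n - r)%N.
  by rewrite addn1 prednK ?subn_gt0.
(* Since D c_(n-r) = pi(A_r), take q = 1 and p = n - r - 1. *)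
apply: (@big_algebra_exists _ (n - r).-1 1).
- exact: equivariant_pi_adj_coef.
- by rewrite e leq_subr.
- have e2 := @KW_char_coef R n m (n - r) (leq_subr r n).
  by rewrite (subKn (ltnW rn)) in e2; rewrite e; exact: (esym e2).
Qed.

Lemma big_const (a : C) : exists G : big, weight_hom G = Func_iota n m a.
Proof.
have Gin : kirillov_const n m a \in @in_big R n m by apply/asboolP/gen_const.
by exists (BigAlgebra Gin); apply: weight_fun_const.
Qed.

Lemma weight_hom_ecoef j : exists G : big, weight_hom G = ecoef R n m j.
Proof.
case: (leqP j n) => [jn|nj]; last first.
  by exists 0; rewrite ecoef_gt // raddf0.
have [G GE] := big_char_coef (leq_subr j n); exists G.
rewrite /weight_hom GE weight_fun_scalar restrict_h_char_coef ?leq_subr //.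
by rewrite subKn.
Qed.

Lemma weight_hom_func_algebra (F : big) : func_algebra (weight_hom F).
Proof.
case: F => K /= Kin; rewrite /weight_hom /=.
have /asboolP Kgen := Kin.
elim: Kgen => {K Kin}
  [K [p [q [pq KE]]]|a|K _ IH|K L _ IHK _ IHL|K L _ IHK _ IHL].
(* For q = 0 the generator is a characteristic coefficient; for q > 0 it is an integer multiple of
   some pi(A_r). *)
- rewrite KE; case: q pq {KE} => [|q] pq.
    rewrite addn0 in pq *; rewrite /= weight_fun_scalar restrict_h_char_coef //.
    exact: func_algebra_ecoef.
  have [z [r ->]] := @iter_KW_char_coef R n m q _ pq.
  set G := pi_mx _ _.
  rewrite weight_fun_scale_int.
  apply: gen_mul; first exact: gen_const.
  rewrite weight_fun_pi_adj_coef.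
  apply: closed_sum => [a|f g|i _].
  + exact: gen_const.
  + exact: gen_add.
  + apply: gen_mul; [exact: func_algebra_psum | exact: func_algebra_ecoef].
- by rewrite weight_fun_const; apply: gen_const.
- have -> : weight_fun (- K : kirillov R n m) = - weight_fun K.
    have := weight_funB 0 K; rewrite sub0r => ->.
    by rewrite weight_fun0 sub0r.
  exact: (gen_opp IH).
- have -> : weight_fun (K + L : kirillov R n m) = weight_fun K + weight_fun L.
    have := weight_funB (K + L) L; rewrite addrK => ->.
    by rewrite subrK.
  exact: (gen_add IHK IHL).
- have -> : weight_fun (K * L : kirillov R n m) = weight_fun K * weight_fun L.
    by apply: weight_funM; apply: (valP K).
  exact: (gen_mul IHK IHL).
Qed.

(** The image is closed under the algebra operations and contains [ecoef]; the elements pi(A_(k-1))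
    supply the sums from which [closed_psum] recovers the power sums. *)
Lemma func_algebra_weight_hom (h : Func) :
  func_algebra h -> exists F : big, weight_hom F = h.
Proof.
pose Q f := exists F : big, weight_hom F = f.
have QC a : Q (Func_iota n m a) by exact: big_const.
have QD f g : Q f -> Q g -> Q (f + g).
  by move=> [F <-] [G <-]; exists (F + G); rewrite raddfD.
have QM f g : Q f -> Q g -> Q (f * g).
  by move=> [F <-] [G <-]; exists (F * G); rewrite rmorphM.
have Qe j : Q (ecoef R n m j) by exact: weight_hom_ecoef.
have Qg k : (0 < k <= n)%N ->
    Q (\sum_(i < n.+1) @psum R n m i * ecoef R n m (k + i)).
  case: k => [//|k] /= kn; have [G GE] := big_pi_adj_coef kn.
  exists G; rewrite /weight_hom GE; exact: weight_fun_pi_adj_coef.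
have Qp := closed_psum QC QD QM Qe Qg.
rewrite -/(Q h).
elim=> {h} [h [h0|h1]|a|f _ IH|f g _ IHf _ IHg|f g _ IHf _ IHg].
- exact: (closed_F0 QC QD QM Qe).
- exact: (closed_F1 QC QD QM Qp).
- exact: QC.
- exact: (closedN QC QM).
- exact: QD.
- exact: QM.
Qed.

Definition gl_direction (A : 'M[C]_n) (c : Sgl) : Sgl :=
  let A' := map_mx (@mpolyC (n * n) C) A in
  \sum_(ij : 'I_n * 'I_n) mderiv (mxvec_index ij.1 ij.2) c
     * (A' *m generic_mx R n - generic_mx R n *m A') ij.1 ij.2.

Lemma gl_direction_derivation A : derivation (gl_direction A).
Proof. by apply: derivation_lincomb => ij; exact: derivation_mderiv. Qed.

Lemma gl_invariantP (c : Sgl) :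
  (forall A, gl_direction A c = 0) <-> gl_invariant c.
Proof.
split=> H A; have := H A.
  by move=> e A'; rewrite pair_big; exact: e.
by rewrite /= pair_big.
Qed.

(** The surjective half of Chevalley restriction for gl_n, with lifts kept inside the big algebra:
    elementary symmetric polynomials lift to the c_k. *)
Lemma chevalley_lift (f : Sh R n) : f \is symmetric ->
  exists c : Sgl, [/\ gl_invariant c, restrict_h c = f &
    exists G : big, (G : polmap R n m) = c%:M].
Proof.
move=> fsym; have [u [<- _]] := sym_fundamental fsym.
elim/mpoly_alg_ind: {f fsym} u =>
  [a|i|p q [c [c1 c2 [F FE]]] [d [d1 d2 [G GE]]]|
    p q [c [c1 c2 [F FE]]] [d [d1 d2 [G GE]]]].
- exists a%:MP; split; last first.
  + have Gin : kirillov_const n m a \in @in_big R n m.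
      exact/asboolP/gen_const.
    by exists (BigAlgebra Gin).
  + by rewrite comp_mpolyC; exact: comp_mpolyC.
  + apply/gl_invariantP => A; apply: big1 => ij _.
    by rewrite mderivC mul0r.
- exists (char_coef R n i.+1); split; last exact: big_char_coef.
  + exact: char_coef_gl_invariant.
  + rewrite restrict_h_char_coef // comp_mpolyXU -tnth_nth tnth_mktuple.
    exact: coef_linear_prod.
- exists (c + d); split.
  + apply/gl_invariantP => A; rewrite (gl_direction_derivation A).1.
    by rewrite (gl_invariantP c).2 // (gl_invariantP d).2 // addr0.
  + by rewrite comp_mpolyD -c2 -d2; exact: (raddfD (@restrict_h R n)).
  + exists (F + G); rewrite raddfD /= -FE -GE; reflexivity.
- exists (c * d); split.
  + apply/gl_invariantP => A; rewrite (gl_direction_derivation A).2.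
    by rewrite (gl_invariantP c).2 // (gl_invariantP d).2 // mulr0 mul0r addr0.
  + have e : restrict_h (c * d) = restrict_h c * restrict_h d.
      exact: (rmorphM (@restrict_h R n)).
    rewrite c2 d2 in e.
    by apply: (etrans e); rewrite [RHS]rmorphM.
  + exists (F * G); rewrite scalar_mxM -FE -GE; reflexivity.
Qed.

(** One-dimensionality of weight spaces: an E_ii at which the exponents of b and mu differ has
    different eigenvalues on the two monomials. *)
Lemma weight_space_support (mu : weight n m) (v : 'cV[C]_#|{: weight n m}|) b :
  weight_space mu v -> b != enum_rank mu -> v b 0 = 0.
Proof.
move=> vmu bmu.
have [i bi] : exists i, basis_mnm b i != weight_mnm mu i.
  apply/existsP; apply: contraNT bmu => /existsPn nb.
  rewrite -(inj_eq enum_val_inj) enum_rankK.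
  apply/eqP/weight_mnm_inj/mnmP => i; apply/eqP.
  by have := nb i; rewrite negbK.
pose d : 'rV[C]_n := delta_mx 0 i.
have dE (a : 'X_{1..n}) : \sum_j d 0 j *+ a j = (a i)%:R.
  rewrite (bigD1 i) //= big1 ?addr0 => [|j /negbTE ji]; rewrite mxE ?eqxx //.
  by rewrite ji andbF mul0rn.
have piE : pi_gl m (diag_mx d) = diag_mx (\row_a (@basis_mnm n m a i)%:R).
  apply/matrixP => a c; rewrite mxE -/(dl _ _) dl_diag dE mcoeffZ mcoeffX.
  rewrite (inj_eq (@basis_mnm_inj n m)) !mxE eq_sym.
  by case: eqP => [->|_]; rewrite ?mulr1 ?mulr0.
have /matrixP/(_ b 0) := vmu d; rewrite piE mul_diag_mx dE mxE [RHS]mxE mxE.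
move/eqP; rewrite -subr_eq0 -mulrBl mulf_eq0 => /orP[|/eqP//].
by rewrite subr_eq0 eqr_nat (negbTE bi).
Qed.

Lemma weight_hom_eigenvalue (F : big) (mu : weight n m) (d : 'rV[C]_n)
    (v : 'cV[C]_#|{: weight n m}|) : weight_space mu v ->
  eval_polmap F (diag_mx d) *m v = (weight_hom F mu).@[fun i => d 0 i] *: v.
Proof.
move=> vmu; apply/matrixP => a z; rewrite (ord1 z) mxE [RHS]mxE.
have Fab b c : eval_polmap F (diag_mx d) b c
    = (restrict_h ((F : polmap R n m) b c)).@[fun i => d 0 i].
  by rewrite mxE meval_restrict_h.
rewrite (bigD1 (enum_rank mu)) //= big1 ?addr0 => [|b bmu]; last first.
  by rewrite (weight_space_support vmu bmu) mulr0.
case: (eqVneq a (enum_rank mu)) => [->|amu].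
  by rewrite Fab /weight_hom weight_funE.
rewrite Fab (restrict_h_offdiag (big_equivariant F) amu) meval0 mul0r.
by rewrite (weight_space_support vmu amu) mulr0.
Qed.

End WeightHomomorphism.

Theorem proposition8p8 (R : realType) (n m : nat)
    (n_ge1 : (1 <= n)%N) (m_ge1 : (1 <= m)%N) :
  exists i_m : {rmorphism big_algebra R n m -> Func R n m},
    [/\ injective i_m,
        (* S(h^* )^W-linearity: f acts on the big algebra as the invariant
           polynomial c restricting to f *)
        forall f : Sh R n, f \is symmetric ->
          exists c : Sgl R n,
            [/\ gl_invariant c, restrict_h c = f &
                forall F : big_algebra R n m,
                  exists2 G : big_algebra R n m,
                    (G : polmap R n m) = c *: (F : polmap R n m) &
                    i_m G = Func_const m f * i_m F],
        forall (F : big_algebra R n m) (mu : weight n m) (d : 'rV[complex R]_n)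
               (v : 'cV[complex R]_#|{: weight n m}|),
          weight_space mu v ->
          eval_polmap F (diag_mx d) *m v = (i_m F mu).@[fun i => d 0 i] *: v
      & forall h : Func R n m,
          (exists F : big_algebra R n m, i_m F = h) <->
          gen_subalgebra (@Func_iota R n m) (fun x => F0 x \/ F1 x) h].
Proof.
exists (@weight_hom R n m : {rmorphism big_algebra R n m -> Func R n m}); split.
- exact: weight_hom_inj.
- move=> f fsym; have [c [c_inv c_res [G0 G0E]]] := chevalley_lift m fsym.
  (* Multiplication by c is multiplication by the scalar map G0, which itself lies in the big
     algebra. *)
  exists c; split=> // F; exists (G0 * F).
    apply: (etrans (congr1 (mulmx^~ (F : polmap R n m)) G0E)).
    exact: mul_scalar_mx.
  rewrite rmorphM; congr (_ * _); rewrite /= /weight_hom G0E.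
  by rewrite weight_fun_scalar c_res.
- exact: weight_hom_eigenvalue.
- move=> h; split=> [[F <-]|]; first exact: weight_hom_func_algebra.
  exact: func_algebra_weight_hom.
Qed.
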